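(* Let $H=U_q(\mathfrak{sl}_2)$ and $C=\mathbb{C}_q[\mathrm{SL}_2]$. An element of $H\otimes C\subset D(H)^*$ is locally finite under the (left and right) actions of $D(H)$ if and only if it is locally finite under the (left and right) actions of $H\subset D(H)$.
   Context: An element is locally finite under the actions of $D(H)$ (resp. $H$) if the $D(H)$-sub-bimodule (resp. $H$-sub-bimodule) it generates is finite-dimensional. The ground field is $\mathbb{C}(q)$. $H=U_q(\mathfrak{sl}_2)$ is the Hopf algebra generated by $K^{\pm1},E,F$ with $KEK^{-1}=q^2E$, $KFK^{-1}=q^{-2}F$, $EF-FE=\frac{K-K^{-1}}{q-q^{-1}}$, $\Delta K=K\otimes K$, $\Delta E=E\otimes K+1\otimes E$, $\Delta F=F\otimes 1+K^{-1}\otimes F$, $\varepsilon(K)=1$, $\varepsilon(E)=\varepsilon(F)=0$, $SK=K^{-1}$, $SE=-EK^{-1}$, $SF=-KF$. $C=\mathbb{C}_q[\mathrm{SL}_2]$ is the Hopf algebra generated by $a,b,c,d$ with $ba=qab$, $ca=qac$, $db=qbd$, $dc=qcd$, $cb=bc$, $ad-q^{-1}bc=da-qbc=1$, $\Delta a=a\otimes a+b\otimes c$, $\Delta b=a\otimes b+b\otimes d$, $\Delta c=c\otimes a+d\otimes c$, $\Delta d=c\otimes b+d\otimes d$, $\varepsilon(a)=\varepsilon(d)=1$, $\varepsilon(b)=\varepsilon(c)=0$, $Sa=d$, $Sb=-qb$, $Sc=-q^{-1}c$, $Sd=a$. The Hopf pairing $\phi\colon C\otimes H\to\mathbb{C}(q)$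 (so $\phi(\gamma,hh')=\phi(\gamma_{(1)},h)\phi(\gamma_{(2)},h')$, $\phi(\gamma\gamma',h)=\phi(\gamma,h_{(1)})\phi(\gamma',h_{(2)})$, $\phi(1,h)=\varepsilon(h)$, $\phi(\gamma,1)=\varepsilon(\gamma)$, $\phi(S\gamma,h)=\phi(\gamma,Sh)$) is determined by $\phi(a,K^{\pm1})=q^{\pm1}$, $\phi(d,K^{\pm1})=q^{\mp1}$, $\phi(b,E)=1$, $\phi(c,F)=1$, and $0$ on all other pairs of generators. The quantum double $D(H)$ is $C\otimes H$ with the tensor product coalgebra structure, containing $C^{\mathrm{op}}$ and $H$ as subalgebras, with cross-relation $h\cdot\gamma=\gamma_{(2)}\cdot h_{(2)}\,\phi(\gamma_{(1)},Sh_{(1)})\,\phi(\gamma_{(3)},h_{(3)})$ for $h\in H$, $\gamma\in C$. $D(H)^*$ is an algebra with product dual to the coproduct, and a $D(H)$-bimodule via $(x\blacktriangleright f)(y)=f(yx)$, $(f\blacktriangleleft x)(y)=f(xy)$. The tensor product algebra $H\otimes C$ is a subalgebra and sub-bimodule of $D(H)^*$ via $\langle\gamma\cdot h,\bar h\otimes\bar\gamma\rangle=\phi(\gamma,\bar h)\phi(\bar\gamma,h)$. *)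

(* Defs.v *)
From HB Require Import structures.
From mathcomp Require Import all_boot all_algebra.
From mathcomp Require Import boolp classical_sets functions reals complex.

Set Implicit Arguments.
Unset Strict Implicit.
Unset Printing Implicit Defensive.

Import GRing.Theory.
Local Open Scope ring_scope.
Local Open Scope quotient_scope.

Definition alg_morphism (K : nzRingType) (A B : lalgType K) (f : A -> B) :=
  linear f /\ monoid_morphism f.

HB.mixin Record hasCounit (K : comNzRingType) A of GRing.Algebra K A := {
  counit : A -> K^o;
  counit_alg_morphism : alg_morphism counit
}.

#[short(type="augAlgType")]
HB.structure Definition AugAlgebra (K : comNzRingType) :=
  {A of GRing.Algebra K A & hasCounit K A}.

HB.instance Definition _ (K : comNzRingType) (A : algType K) :=
  GRing.Lmodule.copy A^c A.
HB.instance Definition _ (K : comNzRingType) (A : algType K) :=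
  GRing.Lmodule_isLalgebra.Build K A^c (fun a x y => @scalerAr K A a y x).
HB.instance Definition _ (K : comNzRingType) (A : algType K) :=
  GRing.Lalgebra_isAlgebra.Build K A^c (fun a x y => @scalerAl K A a y x).

Section AlgebraTerms.
Variables (K : comNzRingType) (I : Type).

Inductive aterm : Type :=
| AGen of I
| AOne
| AAdd of aterm & aterm
| AMul of aterm & aterm
| AScale of K & aterm.

Fixpoint aeval (A : algType K) (f : I -> A) (s : aterm) : A :=
  match s with
  | AGen i => f i
  | AOne => 1
  | AAdd s t => aeval f s + aeval f t
  | AMul s t => aeval f s * aeval f t
  | AScale c s => c *: aeval f s
  end.

Inductive aeqv (rel : aterm -> aterm -> Prop) : aterm -> aterm -> Prop :=
| aeqv_rel s t : rel s t -> aeqv rel s t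
| aeqv_refl s : aeqv rel s s
| aeqv_sym s t : aeqv rel s t -> aeqv rel t s
| aeqv_trans s t u : aeqv rel s t -> aeqv rel t u -> aeqv rel s u
| aeqv_add s s' t t' :
    aeqv rel s s' -> aeqv rel t t' -> aeqv rel (AAdd s t) (AAdd s' t')
| aeqv_mul s s' t t' :
    aeqv rel s s' -> aeqv rel t t' -> aeqv rel (AMul s t) (AMul s' t')
| aeqv_scale c s s' : aeqv rel s s' -> aeqv rel (AScale c s) (AScale c s')
| aeqv_addA s t u : aeqv rel (AAdd s (AAdd t u)) (AAdd (AAdd s t) u)
| aeqv_addC s t : aeqv rel (AAdd s t) (AAdd t s)
| aeqv_add0 s : aeqv rel (AAdd (AScale 0 AOne) s) s
| aeqv_addN s : aeqv rel (AAdd (AScale (-1) s) s) (AScale 0 AOne)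
| aeqv_mulA s t u : aeqv rel (AMul s (AMul t u)) (AMul (AMul s t) u)
| aeqv_mul1l s : aeqv rel (AMul AOne s) s
| aeqv_mul1r s : aeqv rel (AMul s AOne) s
| aeqv_mulDl s t u :
    aeqv rel (AMul (AAdd s t) u) (AAdd (AMul s u) (AMul t u))
| aeqv_mulDr s t u :
    aeqv rel (AMul s (AAdd t u)) (AAdd (AMul s t) (AMul s u))
| aeqv_scaleA c d s : aeqv rel (AScale c (AScale d s)) (AScale (c * d) s)
| aeqv_scale1 s : aeqv rel (AScale 1 s) s
| aeqv_scaleDr c s t :
    aeqv rel (AScale c (AAdd s t)) (AAdd (AScale c s) (AScale c t))
| aeqv_scaleDl c d s :
    aeqv rel (AScale (c + d) s) (AAdd (AScale c s) (AScale d s))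
| aeqv_scaleAl c s t : aeqv rel (AScale c (AMul s t)) (AMul (AScale c s) t)
| aeqv_scaleAr c s t : aeqv rel (AScale c (AMul s t)) (AMul s (AScale c t)).

(* A presentation together with an augmentation; the latter makes the
   presented algebra nontrivial, as algType requires. *)
Record presentation := Presentation {
  prel :> aterm -> aterm -> Prop;
  paug : I -> K^o;
  paugP : forall s t, prel s t -> aeval paug s = aeval paug t
}.

Lemma aeval_eqv (rel : aterm -> aterm -> Prop) (A : algType K) (f : I -> A) :
    (forall s t, rel s t -> aeval f s = aeval f t) ->
  forall s t, aeqv rel s t -> aeval f s = aeval f t.
Proof.
move=> frel s t; elim=> {s t} //=.
- by move=> s t u _ -> _ ->.
- by move=> s s' t t' _ -> _ ->.
- by move=> s s' t t' _ -> _ ->.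
- by move=> c s s' _ ->.
- by move=> s t u; rewrite addrA.
- by move=> s t; rewrite addrC.
- by move=> s; rewrite scale0r add0r.
- by move=> s; rewrite scaleN1r addNr scale0r.
- by move=> s t u; rewrite mulrA.
- by move=> s; rewrite mul1r.
- by move=> s; rewrite mulr1.
- by move=> s t u; rewrite mulrDl.
- by move=> s t u; rewrite mulrDr.
- by move=> c d s; rewrite scalerA.
- by move=> s; rewrite scale1r.
- by move=> c s t; rewrite scalerDr.
- by move=> c d s; rewrite scalerDl.
- by move=> c s t; rewrite scalerAl.
- by move=> c s t; rewrite scalerAr.
Qed.

End AlgebraTerms.

Arguments AOne {K I}.
Arguments AGen {K I} i.

Declare Scope aterm_scope.
Delimit Scope aterm_scope with aterm.
Bind Scope aterm_scope with aterm.
Notation "1" := AOne : aterm_scope.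
Notation "s + t" := (AAdd s t) : aterm_scope.
Notation "s * t" := (AMul s t) : aterm_scope.
Notation "c *: s" := (AScale c s) : aterm_scope.
Notation "s - t" := (AAdd s (AScale (-1) t)) : aterm_scope.

Section PresentedAlgebra.
Variables (K : comNzRingType) (I : Type) (P : presentation K I).
Local Notation T := {classic (aterm K I)}.
Implicit Types s t u : T.

Definition aeqvb : rel T := fun s t => `[< aeqv P s t >].

Lemma aeqvb_refl : reflexive aeqvb.
Proof. by move=> s; apply/asboolP; apply: aeqv_refl. Qed.
Lemma aeqvb_sym : symmetric aeqvb.
Proof. by move=> s t; apply/asboolP/asboolP; apply: aeqv_sym. Qed.
Lemma aeqvb_trans : transitive aeqvb.
Proof.
by move=> t s u /asboolP st /asboolP tu; apply/asboolP/(aeqv_trans st tu).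
Qed.

Canonical aeqv_equiv := EquivRel aeqvb aeqvb_refl aeqvb_sym aeqvb_trans.

Definition palg := {eq_quot aeqv_equiv}.
HB.instance Definition _ := Choice.on palg.
HB.instance Definition _ := EqQuotient.on palg.

Definition pclass (s : T) : palg := \pi s.

Lemma pclassP s t : pclass s = pclass t <-> aeqv P s t.
Proof. by split=> [/eqmodP/asboolP|st]; last exact/eqmodP/asboolP. Qed.

Lemma pclassW (Q : palg -> Prop) : (forall s, Q (pclass s)) -> forall x, Q x.
Proof. by move=> Qs x; rewrite -[x]reprK; apply: Qs. Qed.

Lemma prepr s : aeqv P (repr (pclass s)) s.
Proof. by apply/pclassP; rewrite /pclass reprK. Qed.

Definition padd (x y : palg) := pclass (AAdd (repr x) (repr y)).
Definition pmul (x y : palg) := pclass (AMul (repr x) (repr y)).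
Definition pscale c (x : palg) := pclass (AScale c (repr x)).
Definition pzero := pclass (AScale 0 AOne).
Definition pone := pclass AOne.
Definition popp x := pscale (-1) x.

Lemma paddE s t : padd (pclass s) (pclass t) = pclass (AAdd s t).
Proof. by apply/pclassP/aeqv_add; apply: prepr. Qed.
Lemma pmulE s t : pmul (pclass s) (pclass t) = pclass (AMul s t).
Proof. by apply/pclassP/aeqv_mul; apply: prepr. Qed.
Lemma pscaleE c s : pscale c (pclass s) = pclass (AScale c s).
Proof. by apply/pclassP/aeqv_scale; apply: prepr. Qed.

Local Ltac psolve lem :=
  repeat (elim/pclassW => ?); rewrite /popp ?(paddE, pmulE, pscaleE);
  apply/pclassP; by [apply: lem | apply: aeqv_sym; apply: lem].

Fact paddA : associative padd. Proof. psolve aeqv_addA. Qed.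
Fact paddC : commutative padd. Proof. psolve aeqv_addC. Qed.
Fact padd0 : left_id pzero padd. Proof. rewrite /pzero; psolve aeqv_add0. Qed.
Fact paddN : left_inverse pzero popp padd.
Proof. rewrite /pzero; psolve aeqv_addN. Qed.
Fact pmulA : associative pmul. Proof. psolve aeqv_mulA. Qed.
Fact pmul1l : left_id pone pmul. Proof. rewrite /pone; psolve aeqv_mul1l. Qed.
Fact pmul1r : right_id pone pmul. Proof. rewrite /pone; psolve aeqv_mul1r. Qed.
Fact pmulDl : left_distributive pmul padd. Proof. psolve aeqv_mulDl. Qed.
Fact pmulDr : right_distributive pmul padd. Proof. psolve aeqv_mulDr. Qed.
Fact pscaleA c d x : pscale c (pscale d x) = pscale (c * d) x.
Proof. move: x; psolve aeqv_scaleA. Qed.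
Fact pscale1 : left_id 1 pscale. Proof. psolve aeqv_scale1. Qed.
Fact pscaleDr : right_distributive pscale padd.
Proof. move=> c; psolve aeqv_scaleDr. Qed.
Fact pscaleDl x : {morph pscale^~ x : c d / c + d >-> padd c d}.
Proof. move=> c d; move: x; psolve aeqv_scaleDl. Qed.
Fact pscaleAl c x y : pscale c (pmul x y) = pmul (pscale c x) y.
Proof. move: x y; psolve aeqv_scaleAl. Qed.
Fact pscaleAr c x y : pscale c (pmul x y) = pmul x (pscale c y).
Proof. move: x y; psolve aeqv_scaleAr. Qed.

Fact pone_neq0 : pone != pzero.
Proof.
apply/eqP => /pclassP /(aeval_eqv (@paugP _ _ P)) /=.
by rewrite scale0r; apply/eqP/oner_neq0.
Qed.

HB.instance Definition _ := GRing.isZmodule.Build palg paddA paddC padd0 paddN.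
HB.instance Definition _ := GRing.Zmodule_isNzRing.Build palg
  pmulA pmul1l pmul1r pmulDl pmulDr pone_neq0.
HB.instance Definition _ := GRing.Zmodule_isLmodule.Build K palg
  pscaleA pscale1 pscaleDr pscaleDl.
HB.instance Definition _ := GRing.Lmodule_isLalgebra.Build K palg pscaleAl.
HB.instance Definition _ := GRing.Lalgebra_isAlgebra.Build K palg pscaleAr.

Definition pgen (i : I) : palg := pclass (AGen i).

(* The algebra morphism extending f : I -> A, provided that f satisfies the
   relations (see plift_alg_morphism). *)
Definition plift (A : algType K) (f : I -> A) (x : palg) : A :=
  aeval f (repr x).

Section Lift.
Variables (A : algType K) (f : I -> A).
Hypothesis frel : forall s t, P s t -> aeval f s = aeval f t.

Lemma plift_pclass s : plift f (pclass s) = aeval f s.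
Proof. exact/(aeval_eqv frel)/prepr. Qed.

Lemma plift_gen i : plift f (pgen i) = f i.
Proof. exact: plift_pclass. Qed.

Lemma plift_alg_morphism : alg_morphism (plift f).
Proof.
split; last split.
- move=> c; elim/pclassW=> s; elim/pclassW=> t.
  by rewrite [c *: _]pscaleE [_ + _]paddE !plift_pclass.
- exact: plift_pclass.
- by elim/pclassW=> s; elim/pclassW=> t; rewrite [_ * _]pmulE !plift_pclass.
Qed.

End Lift.

Lemma aeval_pgen s : aeval pgen s = pclass s.
Proof.
elim: s => /= [i||s -> t ->|s -> t ->|c s ->] //.
- exact: paddE.
- exact: pmulE.
- exact: pscaleE.
Qed.

Lemma pgen_rel s t : P s t -> aeval pgen s = aeval pgen t.
Proof. by move=> Pst; rewrite !aeval_pgen; apply/pclassP/aeqv_rel. Qed.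

Lemma palg_ind (Q : palg -> Prop) :
    (forall i, Q (pgen i)) -> Q 1 ->
    (forall x y, Q x -> Q y -> Q (x + y)) ->
    (forall x y, Q x -> Q y -> Q (x * y)) ->
    (forall c x, Q x -> Q (c *: x)) ->
  forall x, Q x.
Proof.
move=> Qg Q1 QD QM QZ; elim/pclassW=> s; rewrite -aeval_pgen.
by elim: s => //= *; auto.
Qed.

HB.instance Definition _ := hasCounit.Build K palg
  (plift_alg_morphism (@paugP _ _ P)).

Lemma counit_gen i : counit (pgen i) = paug P i.
Proof. exact: (plift_gen (@paugP _ _ P)). Qed.

End PresentedAlgebra.

Arguments pgen {K I} P i.

Section TensorTerms.
Variables (K : comNzRingType) (V W : lmodType K).

Inductive tterm : Type :=
| TPure of V & W
| TAdd of tterm & tterm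
| TScale of K & tterm.

Inductive teqv : tterm -> tterm -> Prop :=
| teqv_refl s : teqv s s
| teqv_sym s t : teqv s t -> teqv t s
| teqv_trans s t u : teqv s t -> teqv t u -> teqv s u
| teqv_add s s' t t' : teqv s s' -> teqv t t' -> teqv (TAdd s t) (TAdd s' t')
| teqv_scale c s s' : teqv s s' -> teqv (TScale c s) (TScale c s')
| teqv_addA s t u : teqv (TAdd s (TAdd t u)) (TAdd (TAdd s t) u)
| teqv_addC s t : teqv (TAdd s t) (TAdd t s)
| teqv_add0 s : teqv (TAdd (TPure 0 0) s) s
| teqv_addN s : teqv (TAdd (TScale (-1) s) s) (TPure 0 0)
| teqv_scaleA c d s : teqv (TScale c (TScale d s)) (TScale (c * d) s)
| teqv_scale1 s : teqv (TScale 1 s) s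
| teqv_scaleDr c s t :
    teqv (TScale c (TAdd s t)) (TAdd (TScale c s) (TScale c t))
| teqv_scaleDl c d s : teqv (TScale (c + d) s) (TAdd (TScale c s) (TScale d s))
| teqv_pureDl v v' w :
    teqv (TPure (v + v') w) (TAdd (TPure v w) (TPure v' w))
| teqv_pureDr v w w' :
    teqv (TPure v (w + w')) (TAdd (TPure v w) (TPure v w'))
| teqv_pureZl c v w : teqv (TPure (c *: v) w) (TScale c (TPure v w))
| teqv_pureZr c v w : teqv (TPure v (c *: w)) (TScale c (TPure v w)).

Fixpoint teval (U : lmodType K) (b : V -> W -> U) (s : tterm) : U :=
  match s with
  | TPure v w => b v w
  | TAdd s t => teval b s + teval b t
  | TScale c s => c *: teval b s
  end.

End TensorTerms.

Notation bilinear_map := (bilinear_for *:%R *:%R).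

Section Bilinear.
Variables (K : comNzRingType) (V W U : lmodType K) (b : V -> W -> U).
Hypothesis bb : bilinear_map b.

Lemma bmDl v v' w : b (v + v') w = b v w + b v' w.
Proof. by have := bb.1 w 1 v v'; rewrite /= !scale1r. Qed.
Lemma bmDr v w w' : b v (w + w') = b v w + b v w'.
Proof. by have := bb.2 v 1 w w'; rewrite /= !scale1r. Qed.
Lemma bm0l w : b 0 w = 0.
Proof. by apply: (addrI (b 0 w)); rewrite -bmDl !addr0. Qed.
Lemma bm0r v : b v 0 = 0.
Proof. by apply: (addrI (b v 0)); rewrite -bmDr !addr0. Qed.
Lemma bmZl c v w : b (c *: v) w = c *: b v w.
Proof. by have := bb.1 w c v 0; rewrite /= bm0l !addr0. Qed.
Lemma bmZr c v w : b v (c *: w) = c *: b v w.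
Proof. by have := bb.2 v c w 0; rewrite /= bm0r !addr0. Qed.

Lemma teval_eqv s t : teqv s t -> teval b s = teval b t.
Proof.
elim=> {s t} //=.
- by move=> s t u _ -> _ ->.
- by move=> s s' t t' _ -> _ ->.
- by move=> c s s' _ ->.
- by move=> s t u; rewrite addrA.
- by move=> s t; rewrite addrC.
- by move=> s; rewrite bm0l add0r.
- by move=> s; rewrite bm0l scaleN1r addNr.
- by move=> c d s; rewrite scalerA.
- by move=> s; rewrite scale1r.
- by move=> c s t; rewrite scalerDr.
- by move=> c d s; rewrite scalerDl.
- by move=> v v' w; rewrite bmDl.
- by move=> v w w'; rewrite bmDr.
- by move=> c v w; rewrite bmZl.
- by move=> c v w; rewrite bmZr.
Qed.

End Bilinear.

Section Tensor.
Variables (K : comNzRingType) (V W : lmodType K).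
Local Notation T := {classic (tterm V W)}.
Implicit Types s t u : T.

Definition teqvb : rel T := fun s t => `[< teqv s t >].

Lemma teqvb_refl : reflexive teqvb.
Proof. by move=> s; apply/asboolP; apply: teqv_refl. Qed.
Lemma teqvb_sym : symmetric teqvb.
Proof. by move=> s t; apply/asboolP/asboolP; apply: teqv_sym. Qed.
Lemma teqvb_trans : transitive teqvb.
Proof.
by move=> t s u /asboolP st /asboolP tu; apply/asboolP/(teqv_trans st tu).
Qed.

Canonical teqv_equiv := EquivRel teqvb teqvb_refl teqvb_sym teqvb_trans.

Definition tensor := {eq_quot teqv_equiv}.
HB.instance Definition _ := Choice.on tensor.
HB.instance Definition _ := EqQuotient.on tensor.

Definition tclass (s : T) : tensor := \pi s.

Lemma tclassP s t : tclass s = tclass t <-> teqv s t.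
Proof. by split=> [/eqmodP/asboolP|st]; last exact/eqmodP/asboolP. Qed.

Lemma tclassW (Q : tensor -> Prop) : (forall s, Q (tclass s)) -> forall x, Q x.
Proof. by move=> Qs x; rewrite -[x]reprK; apply: Qs. Qed.

Lemma trepr s : teqv (repr (tclass s)) s.
Proof. by apply/tclassP; rewrite /tclass reprK. Qed.

Definition tens (v : V) (w : W) : tensor := tclass (TPure v w).
Definition tadd (x y : tensor) := tclass (TAdd (repr x) (repr y)).
Definition tscale c (x : tensor) := tclass (TScale c (repr x)).
Definition tzero := tens 0 0.
Definition topp x := tscale (-1) x.

Lemma taddE s t : tadd (tclass s) (tclass t) = tclass (TAdd s t).
Proof. by apply/tclassP/teqv_add; apply: trepr. Qed.
Lemma tscaleE c s : tscale c (tclass s) = tclass (TScale c s).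
Proof. by apply/tclassP/teqv_scale; apply: trepr. Qed.

Local Ltac tsolve lem :=
  repeat (elim/tclassW => ?); rewrite /topp ?(taddE, tscaleE);
  apply/tclassP; by [apply: lem | apply: teqv_sym; apply: lem].

Fact taddA : associative tadd. Proof. tsolve teqv_addA. Qed.
Fact taddC : commutative tadd. Proof. tsolve teqv_addC. Qed.
Fact tadd0 : left_id tzero tadd.
Proof. rewrite /tzero /tens; tsolve teqv_add0. Qed.
Fact taddN : left_inverse tzero topp tadd.
Proof. rewrite /tzero /tens; tsolve teqv_addN. Qed.
Fact tscaleA c d x : tscale c (tscale d x) = tscale (c * d) x.
Proof. move: x; tsolve teqv_scaleA. Qed.
Fact tscale1 : left_id 1 tscale. Proof. tsolve teqv_scale1. Qed.
Fact tscaleDr : right_distributive tscale tadd.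
Proof. move=> c; tsolve teqv_scaleDr. Qed.
Fact tscaleDl x : {morph tscale^~ x : c d / c + d >-> tadd c d}.
Proof. move=> c d; move: x; tsolve teqv_scaleDl. Qed.

HB.instance Definition _ := GRing.isZmodule.Build tensor taddA taddC tadd0 taddN.
HB.instance Definition _ := GRing.Zmodule_isLmodule.Build K tensor
  tscaleA tscale1 tscaleDr tscaleDl.

Lemma tens_bilinear : bilinear_map tens.
Proof.
have tZ c v w : c *: tens v w = tclass (TScale c (TPure v w)).
  exact: tscaleE.
have tD x y : tclass x + tclass y = tclass (TAdd x y) by exact: taddE.
split=> [w c v v'|v c w w'] /=; rewrite tZ tD; apply/tclassP.
  apply: (teqv_trans (teqv_pureDl _ _ _)).
  by apply: teqv_add; [apply: teqv_pureZl | apply: teqv_refl].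
apply: (teqv_trans (teqv_pureDr _ _ _)).
by apply: teqv_add; [apply: teqv_pureZr | apply: teqv_refl].
Qed.

Lemma tensor_ind (Q : tensor -> Prop) :
    (forall v w, Q (tens v w)) -> (forall x y, Q x -> Q y -> Q (x + y)) ->
  forall x, Q x.
Proof.
move=> Qt QD; elim/tclassW.
suff Qs s c : Q (c *: tclass s) by move=> s; rewrite -[tclass s]scale1r.
elim: s c => [v w|s IHs t IHt|d s IHs] c.
- by rewrite -[_ *: _](bmZl tens_bilinear).
- by rewrite -[tclass _]taddE scalerDr; apply: QD.
- by rewrite -[tclass _]tscaleE scalerA.
Qed.

(* The linear map induced by b on the tensor product, provided that b is
   bilinear (see tensor_lift_tens and tensor_lift_linear). *)
Definition tensor_lift (U : lmodType K) (b : V -> W -> U) (x : tensor) : U :=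
  teval b (repr x).

Section Lift.
Variables (U : lmodType K) (b : V -> W -> U).
Hypothesis bb : bilinear_map b.

Lemma tensor_lift_tclass s : tensor_lift b (tclass s) = teval b s.
Proof. exact/(teval_eqv bb)/trepr. Qed.

Lemma tensor_lift_tens v w : tensor_lift b (tens v w) = b v w.
Proof. exact: tensor_lift_tclass. Qed.

Lemma tensor_lift_linear : linear (tensor_lift b).
Proof.
move=> c; elim/tclassW=> s; elim/tclassW=> t.
by rewrite [c *: _]tscaleE [_ + _]taddE !tensor_lift_tclass.
Qed.

End Lift.

Lemma tensor_lift_param (X U : lmodType K) (b : X -> V -> W -> U) (t : tensor) :
    (forall v w, linear (fun x => b x v w)) ->
  linear (fun x => tensor_lift (b x) t).
Proof.
move=> lb c x y; rewrite /tensor_lift; elim: (repr t : tterm V W) => /=.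
- by move=> v w; apply: lb.
- by move=> s -> u ->; rewrite scalerDr addrACA.
- by move=> d s ->; rewrite scalerDr !scalerA mulrC.
Qed.

End Tensor.

Arguments tensor_lift {K V W U} b x.

Section TensorAlgebra.
Variables (K : comNzRingType) (A B : augAlgType K).
Local Notation AB := (tensor A B).

Lemma mul_bilinear (D : algType K) : bilinear_map (fun x y : D => x * y).
Proof.
split=> [y c x x'|x c y y'] /=; first by rewrite mulrDl scalerAl.
by rewrite mulrDr scalerAr.
Qed.

Fact tmul_bilinear2 (a : A) (b : B) :
  bilinear_map (fun a' b' => tens (a * a') (b * b')).
Proof.
by split=> [v c x y|v c x y] /=; rewrite mulrDr -scalerAr;
  rewrite ?(bmDl (tens_bilinear _ _)) ?(bmDr (tens_bilinear _ _))
    ?(bmZl (tens_bilinear _ _)) ?(bmZr (tens_bilinear _ _)).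
Qed.

Fact tmul_bilinear1 (y : AB) :
  bilinear_map (fun a b =>
    tensor_lift (fun a' b' => tens (a * a') (b * b')) y : AB).
Proof.
split=> [v|v]; apply: tensor_lift_param => a' b' c x x' /=;
  rewrite mulrDl -scalerAl;
  rewrite ?(bmDl (tens_bilinear _ _)) ?(bmDr (tens_bilinear _ _))
    ?(bmZl (tens_bilinear _ _)) ?(bmZr (tens_bilinear _ _)) //.
Qed.

Definition tmul (x y : AB) : AB :=
  tensor_lift (fun a b =>
    tensor_lift (fun a' b' => tens (a * a') (b * b')) y) x.

Lemma tmul_tens a b a' b' :
  tmul (tens a b) (tens a' b') = tens (a * a') (b * b').
Proof.
by rewrite /tmul (tensor_lift_tens (tmul_bilinear1 _))
  (tensor_lift_tens (tmul_bilinear2 _ _)).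
Qed.

Fact tmul_bilinear : bilinear_map tmul.
Proof.
split=> [y|x]; first exact: (tensor_lift_linear (tmul_bilinear1 y)).
apply: tensor_lift_param => a b.
exact: (tensor_lift_linear (tmul_bilinear2 a b)).
Qed.

Fact tmulDl : left_distributive tmul +%R.
Proof. by move=> x y z; apply: (bmDl tmul_bilinear). Qed.
Fact tmulDr : right_distributive tmul +%R.
Proof. by move=> x y z; apply: (bmDr tmul_bilinear). Qed.

Fact tmulA : associative tmul.
Proof.
elim/tensor_ind=> [a b|x x' IHx IHx'] y z; last by rewrite !tmulDl IHx IHx'.
elim/tensor_ind: y => [a' b'|y y' IHy IHy']; last first.
  by rewrite !(tmulDl, tmulDr) IHy IHy'.
elim/tensor_ind: z => [a'' b''|z z' IHz IHz']; last by rewrite !tmulDr IHz IHz'.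
by rewrite !tmul_tens !mulrA.
Qed.

Fact tmul1l : left_id (tens 1 1) tmul.
Proof.
elim/tensor_ind=> [a b|x y IHx IHy]; first by rewrite tmul_tens !mul1r.
by rewrite tmulDr IHx IHy.
Qed.

Fact tmul1r : right_id (tens 1 1) tmul.
Proof.
elim/tensor_ind=> [a b|x y IHx IHy]; first by rewrite tmul_tens !mulr1.
by rewrite tmulDl IHx IHy.
Qed.

Fact tcounit_bilinear :
  bilinear_map (fun (a : A) (b : B) => counit a * counit b : K^o).
Proof.
split=> [v c x y|v c x y] /=.
  rewrite (@counit_alg_morphism K A).1.
  by rewrite mulrDl -scalerAl.
rewrite (@counit_alg_morphism K B).1.
by rewrite mulrDr -scalerAr.
Qed.

Definition tcounit : AB -> K^o :=
  tensor_lift (fun a b => counit a * counit b : K^o).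

Fact tone_neq0 : tens 1 1 != 0 :> AB.
Proof.
apply/eqP => /(congr1 tcounit).
rewrite /tcounit (tensor_lift_tens tcounit_bilinear).
rewrite (_ : 0 = tens 0 0 :> AB) // (tensor_lift_tens tcounit_bilinear).
rewrite (bm0l tcounit_bilinear) !(@counit_alg_morphism K _).2 mulr1.
exact/eqP/oner_neq0.
Qed.

HB.instance Definition _ := GRing.Zmodule_isNzRing.Build AB
  tmulA tmul1l tmul1r tmulDl tmulDr tone_neq0.
HB.instance Definition _ := GRing.Lmodule_isLalgebra.Build K AB
  (fun c x y => esym (bmZl tmul_bilinear c x y)).
HB.instance Definition _ := GRing.Lalgebra_isAlgebra.Build K AB
  (fun c x y => esym (bmZr tmul_bilinear c x y)).

Lemma tensM (a a' : A) (b b' : B) :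
  tens a b * tens a' b' = tens (a * a') (b * b').
Proof. exact: tmul_tens. Qed.

Lemma tens1 : tens 1 1 = 1 :> AB.
Proof. by []. Qed.

Fact tcounit_alg_morphism : alg_morphism tcounit.
Proof.
split; first exact: (tensor_lift_linear tcounit_bilinear).
have tE a b : tcounit (tens a b) = counit a * counit b.
  exact: (tensor_lift_tens tcounit_bilinear).
have tD x y : tcounit (x + y) = tcounit x + tcounit y.
  by have := tensor_lift_linear tcounit_bilinear 1 x y; rewrite !scale1r.
split; first by rewrite -tens1 tE !(@counit_alg_morphism K _).2 mulr1.
elim/tensor_ind=> [a b|x x' IHx IHx'] y; last first.
  by rewrite mulrDl !tD IHx IHx' mulrDl.
elim/tensor_ind: y => [a' b'|y y' IHy IHy']; last first.
  by rewrite mulrDr !tD IHy IHy' mulrDr.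
by rewrite tensM !tE !(@counit_alg_morphism K _).2 mulrACA.
Qed.

HB.instance Definition _ := hasCounit.Build K AB tcounit_alg_morphism.

End TensorAlgebra.

Section TensorRelations.
Variables (K : fieldType) (q : K) (A : augAlgType K).
Hypothesis q_neq0 : q != 0.
Local Notation tensDl := (bmDl (tens_bilinear _ _)).
Local Notation tensDr := (bmDr (tens_bilinear _ _)).
Local Notation tensZl := (bmZl (tens_bilinear _ _)).
Local Notation tensZr := (bmZr (tens_bilinear _ _)).

Section U.
Variables (k k' e f : A).
Hypothesis kk' : k * k' = 1.
Let De := tens e k + tens 1 e.
Let Df := tens f 1 + tens k' f.

Lemma usl2_tens_KE : k * e * k' = q ^+ 2 *: e ->
  tens k k * De * tens k' k' = q ^+ 2 *: De.
Proof.
move=> ke; rewrite /De !(mulrDl, mulrDr) !tensM mulr1 kk' ke -mulrA kk' mulr1.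
by rewrite tensZl tensZr scalerDr.
Qed.

Lemma usl2_tens_KF : k * f * k' = q ^- 2 *: f ->
  tens k k * Df * tens k' k' = q ^- 2 *: Df.
Proof.
move=> kf; rewrite /Df !(mulrDl, mulrDr) !tensM mulr1 kk' kf mul1r.
by rewrite tensZl tensZr scalerDr.
Qed.

Lemma usl2_tens_EF :
    e * f = f * e + (q - q^-1)^-1 *: (k - k') ->
    e * k' = q ^+ 2 *: (k' * e) -> k * f = q ^- 2 *: (f * k) ->
  De * Df - Df * De = (q - q^-1)^-1 *: (tens k k - tens k' k').
Proof.
move=> ef ek kf.
rewrite /De /Df !(mulrDl, mulrDr) !tensM !mul1r !mulr1 ef ek kf.
rewrite tensZl tensZr scalerA divff ?expf_neq0 // scale1r.
rewrite tensDl tensDr tensZl tensZr tensDl tensDr.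
rewrite -!(scaleN1r k') tensZl tensZr !scaleN1r.
rewrite [X in X - _](AC ((1*1*1)*(1*(1*1))) ((1*4*(3*5))*(2*6))) /=.
by rewrite [LHS]addrC addKr -scalerDr [X in _ *: X]addrA subrK.
Qed.
End U.

Section O.
Variables (a b c d : A).
Hypotheses (ba : b * a = q *: (a * b)) (ca : c * a = q *: (a * c)).
Hypotheses (db : d * b = q *: (b * d)) (dc : d * c = q *: (c * d)).
Hypotheses (cb : c * b = b * c).
Hypotheses (ad : a * d = 1 + q^-1 *: (b * c)).
Hypotheses (da : d * a = 1 + q *: (b * c)).
Let Da := tens a a + tens b c.
Let Db := tens a b + tens b d.
Let Dc := tens c a + tens d c.
Let Dd := tens c b + tens d d.

Local Ltac osimp :=
  rewrite /Da /Db /Dc /Dd ?(mulrDl, mulrDr) ?tensM ?(ba, ca, db, dc, cb, ad, da)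
    ?(tensDl, tensDr, tensZl, tensZr) ?(scalerDr, scalerA)
    ?divff ?mulVf ?scale1r //.

Lemma osl2_tens :
  (Db * Da = q *: (Da * Db)) * (Dc * Da = q *: (Da * Dc)) *
  (Dd * Db = q *: (Db * Dd)) * (Dd * Dc = q *: (Dc * Dd)) *
  (Dc * Db = Db * Dc) * (Da * Dd - q^-1 *: (Db * Dc) = 1) *
  (Dd * Da - q *: (Db * Dc) = 1).
Proof.
do 6?split; osimp.
1-4: by rewrite [LHS](AC ((1*1)*(1*1*1)) ((1*(3*2))*(4*5))).
- by rewrite [LHS](AC ((1*(1*1))*(1*1*1)) ((1*(4*3))*(2*5*6))).
- rewrite [X in X - _](AC ((1*(1*1*(1*1))*(1*1))) ((1*(3*5)*(4*6*7))*2)) /=.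
  by rewrite [LHS]addrC addKr.
- rewrite [X in X - _](AC ((1*1)*(1*1*(1*1)*1)) ((1*(4*2)*(5*6*7))*3)) /=.
  by rewrite [LHS]addrC addKr.
Qed.
End O.
End TensorRelations.

Section QuantumSL2.
Variables (K : fieldType) (q : K).

Inductive usl2_gen := gK | gKinv | gE | gF.
Local Notation K_ := (AGen gK : aterm K usl2_gen).
Local Notation K' := (AGen gKinv : aterm K usl2_gen).
Local Notation E := (AGen gE : aterm K usl2_gen).
Local Notation F := (AGen gF : aterm K usl2_gen).

Inductive usl2_rel : aterm K usl2_gen -> aterm K usl2_gen -> Prop :=
| usl2_KKinv : usl2_rel (K_ * K')%aterm 1%aterm
| usl2_KinvK : usl2_rel (K' * K_)%aterm 1%aterm
| usl2_KE : usl2_rel (K_ * E * K')%aterm (q ^+ 2 *: E)%aterm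
| usl2_KF : usl2_rel (K_ * F * K')%aterm (q ^- 2 *: F)%aterm
| usl2_EF : usl2_rel (E * F - F * E)%aterm ((q - q^-1)^-1 *: (K_ - K'))%aterm.

Definition usl2_aug (g : usl2_gen) : K^o :=
  match g with gK | gKinv => 1 | gE | gF => 0 end.

Fact usl2_augP s t : usl2_rel s t -> aeval usl2_aug s = aeval usl2_aug t.
Proof.
by case=> /=; rewrite ?(scaler0, mulr0, mul0r, mulr1, scaleN1r, subrr, addr0).
Qed.

(* H = U_q(sl_2) *)
Definition usl2_pres := Presentation usl2_augP.
Definition Uq := palg usl2_pres.
HB.instance Definition _ := AugAlgebra.on Uq.

Inductive osl2_gen := ga | gb | gc | gd.
Local Notation a := (AGen ga : aterm K osl2_gen).
Local Notation b := (AGen gb : aterm K osl2_gen).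
Local Notation c := (AGen gc : aterm K osl2_gen).
Local Notation d := (AGen gd : aterm K osl2_gen).

Inductive osl2_rel : aterm K osl2_gen -> aterm K osl2_gen -> Prop :=
| osl2_ba : osl2_rel (b * a)%aterm (q *: (a * b))%aterm
| osl2_ca : osl2_rel (c * a)%aterm (q *: (a * c))%aterm
| osl2_db : osl2_rel (d * b)%aterm (q *: (b * d))%aterm
| osl2_dc : osl2_rel (d * c)%aterm (q *: (c * d))%aterm
| osl2_cb : osl2_rel (c * b)%aterm (b * c)%aterm
| osl2_ad : osl2_rel (a * d - q^-1 *: (b * c))%aterm 1%aterm
| osl2_da : osl2_rel (d * a - q *: (b * c))%aterm 1%aterm.

Definition osl2_aug (g : osl2_gen) : K^o :=
  match g with ga | gd => 1 | gb | gc => 0 end.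

Fact osl2_augP s t : osl2_rel s t -> aeval osl2_aug s = aeval osl2_aug t.
Proof.
by case=> /=; rewrite ?(scaler0, mulr0, mul0r, mulr1, scaleN1r, subr0, addr0).
Qed.

(* C = C_q[SL_2] *)
Definition osl2_pres := Presentation osl2_augP.
Definition Oq := palg osl2_pres.
HB.instance Definition _ := AugAlgebra.on Oq.

Definition uK : Uq := pgen usl2_pres gK.
Definition uKinv : Uq := pgen usl2_pres gKinv.
Definition uE : Uq := pgen usl2_pres gE.
Definition uF : Uq := pgen usl2_pres gF.

Definition oa : Oq := pgen osl2_pres ga.
Definition ob : Oq := pgen osl2_pres gb.
Definition oc : Oq := pgen osl2_pres gc.
Definition od : Oq := pgen osl2_pres gd.

Definition usl2_coproduct_on (g : usl2_gen) : tensor Uq Uq :=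
  match g with
  | gK => tens uK uK
  | gKinv => tens uKinv uKinv
  | gE => tens uE uK + tens 1 uE
  | gF => tens uF 1 + tens uKinv uF
  end.

Definition osl2_coproduct_on (g : osl2_gen) : tensor Oq Oq :=
  match g with
  | ga => tens oa oa + tens ob oc
  | gb => tens oa ob + tens ob od
  | gc => tens oc oa + tens od oc
  | gd => tens oc ob + tens od od
  end.

Definition usl2_coproduct : Uq -> tensor Uq Uq := plift usl2_coproduct_on.
Definition osl2_coproduct : Oq -> tensor Oq Oq := plift osl2_coproduct_on.

(* The antipodes are algebra morphisms to the opposite algebra. *)
Definition usl2_antipode_on (g : usl2_gen) : Uq :=
  match g with
  | gK => uKinv
  | gKinv => uK
  | gE => - (uE * uKinv)
  | gF => - (uK * uF)
  end.

Definition osl2_antipode_on (g : osl2_gen) : Oq :=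
  match g with
  | ga => od
  | gb => - (q *: ob)
  | gc => - (q^-1 *: oc)
  | gd => oa
  end.

Definition usl2_antipode : Uq -> Uq := plift (A := Uq^c) usl2_antipode_on.
Definition osl2_antipode : Oq -> Oq := plift (A := Oq^c) osl2_antipode_on.

Section WellDefined.
Hypothesis q_neq0 : q != 0.

Lemma uKKinv : uK * uKinv = 1.
Proof. exact: (pgen_rel (P := usl2_pres) usl2_KKinv). Qed.
Lemma uKinvK : uKinv * uK = 1.
Proof. exact: (pgen_rel (P := usl2_pres) usl2_KinvK). Qed.
Lemma uKEKinv : uK * uE * uKinv = q ^+ 2 *: uE.
Proof. exact: (pgen_rel (P := usl2_pres) usl2_KE). Qed.
Lemma uKFKinv : uK * uF * uKinv = q ^- 2 *: uF.
Proof. exact: (pgen_rel (P := usl2_pres) usl2_KF). Qed.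
Lemma uKE : uK * uE = q ^+ 2 *: (uE * uK).
Proof. by rewrite scalerAl -uKEKinv -[_ * _ * uK]mulrA uKinvK mulr1. Qed.
Lemma uKF : uK * uF = q ^- 2 *: (uF * uK).
Proof. by rewrite scalerAl -uKFKinv -[_ * _ * uK]mulrA uKinvK mulr1. Qed.
Lemma uEF : uE * uF = uF * uE + (q - q^-1)^-1 *: (uK - uKinv).
Proof.
have := pgen_rel (P := usl2_pres) usl2_EF.
rewrite /= !scaleN1r -/uE -/uF -/uK -/uKinv => <-.
by rewrite addrC subrK.
Qed.
Lemma uEKinv : uE * uKinv = q ^+ 2 *: (uKinv * uE).
Proof.
rewrite -[uE in LHS]mul1r -uKinvK -[uKinv * uK * _]mulrA uKE.
by rewrite -scalerAr -scalerAl -!mulrA uKKinv mulr1.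
Qed.
Lemma uKinvF : uKinv * uF = q ^+ 2 *: (uF * uKinv).
Proof.
have : uKinv * (uK * uF) * uKinv = q ^- 2 *: (uKinv * uF).
  by rewrite uKF -scalerAr -scalerAl -!mulrA uKKinv mulr1.
rewrite [uKinv * _]mulrA uKinvK mul1r => ->.
by rewrite scalerA divff ?scale1r // expf_neq0.
Qed.

Lemma oba : ob * oa = q *: (oa * ob).
Proof. exact: (pgen_rel (P := osl2_pres) osl2_ba). Qed.
Lemma oca : oc * oa = q *: (oa * oc).
Proof. exact: (pgen_rel (P := osl2_pres) osl2_ca). Qed.
Lemma odb : od * ob = q *: (ob * od).
Proof. exact: (pgen_rel (P := osl2_pres) osl2_db). Qed.
Lemma odc : od * oc = q *: (oc * od).
Proof. exact: (pgen_rel (P := osl2_pres) osl2_dc). Qed.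
Lemma ocb : oc * ob = ob * oc.
Proof. exact: (pgen_rel (P := osl2_pres) osl2_cb). Qed.
Lemma oad : oa * od = 1 + q^-1 *: (ob * oc).
Proof.
have := pgen_rel (P := osl2_pres) osl2_ad.
by rewrite /= !scaleN1r -/oa -/ob -/oc -/od => <-; rewrite subrK.
Qed.
Lemma oda : od * oa = 1 + q *: (ob * oc).
Proof.
have := pgen_rel (P := osl2_pres) osl2_da.
by rewrite /= !scaleN1r -/oa -/ob -/oc -/od => <-; rewrite subrK.
Qed.

Lemma usl2_coproduct_rel s t : usl2_rel s t ->
  aeval usl2_coproduct_on s = aeval usl2_coproduct_on t.
Proof.
case=> /=; rewrite ?scaleN1r.
- by rewrite tensM uKKinv.
- by rewrite tensM uKinvK.
- exact: (usl2_tens_KE uKKinv uKEKinv).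
- exact: (usl2_tens_KF uKKinv uKFKinv).
- exact: (usl2_tens_EF q_neq0 uEF uEKinv uKF).
Qed.

Lemma usl2_coproduct_alg : alg_morphism usl2_coproduct.
Proof. exact/plift_alg_morphism/usl2_coproduct_rel. Qed.

Lemma usl2_antipode_rel s t : usl2_rel s t ->
  aeval (A := Uq^c) usl2_antipode_on s = aeval (A := Uq^c) usl2_antipode_on t.
Proof.
case=> /=; rewrite ?scaleN1r.
- exact: uKKinv.
- exact: uKinvK.
- change (uK * (- (uE * uKinv) * uKinv) = q ^+ 2 *: - (uE * uKinv)).
  by rewrite mulNr mulrN !mulrA uKE -!scalerAl -(mulrA uE) uKKinv mulr1 scalerN.
- change (uK * (- (uK * uF) * uKinv) = q ^- 2 *: - (uK * uF)).
  by rewrite mulNr mulrN uKFKinv -scalerAr scalerN.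
- change (- (uK * uF) * - (uE * uKinv) - - (uE * uKinv) * - (uK * uF)
    = (q - q^-1)^-1 *: (uKinv - uK)).
  have -> : - (uK * uF) * - (uE * uKinv) = uF * uE.
    rewrite mulrNN uKF uEKinv -scalerAl -scalerAr scalerA mulVf ?expf_neq0 //.
    by rewrite scale1r -mulrA (mulrA uK) uKKinv mul1r.
  rewrite mulrNN -mulrA (mulrA uKinv) uKinvK mul1r uEF opprD addNKr.
  by rewrite -scalerN opprB.
Qed.

Lemma usl2_antipode_alg : alg_morphism (usl2_antipode : Uq -> Uq^c).
Proof. exact/plift_alg_morphism/usl2_antipode_rel. Qed.

Lemma osl2_coproduct_rel s t : osl2_rel s t ->
  aeval osl2_coproduct_on s = aeval osl2_coproduct_on t.
Proof.
pose H := osl2_tens q_neq0 oba oca odb odc ocb oad oda.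
by case=> /=; rewrite ?scaleN1r; apply H.
Qed.

Lemma osl2_coproduct_alg : alg_morphism osl2_coproduct.
Proof. exact/plift_alg_morphism/osl2_coproduct_rel. Qed.

Lemma osl2_antipode_rel s t : osl2_rel s t ->
  aeval (A := Oq^c) osl2_antipode_on s = aeval (A := Oq^c) osl2_antipode_on t.
Proof.
case=> /=; rewrite ?scaleN1r.
- change (od * - (q *: ob) = q *: (- (q *: ob) * od)).
  by rewrite mulNr mulrN -scalerAr -scalerAl odb scalerN.
- change (od * - (q^-1 *: oc) = q *: (- (q^-1 *: oc) * od)).
  by rewrite mulNr mulrN -scalerAr -scalerAl odc scalerN scalerA mulrC -scalerA.
- change (- (q *: ob) * oa = q *: (oa * - (q *: ob))).
  by rewrite mulNr mulrN -scalerAr -scalerAl oba scalerN.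
- change (- (q^-1 *: oc) * oa = q *: (oa * - (q^-1 *: oc))).
  by rewrite mulNr mulrN -scalerAr -scalerAl oca scalerN scalerA mulrC -scalerA.
- change (- (q *: ob) * - (q^-1 *: oc) = - (q^-1 *: oc) * - (q *: ob)).
  rewrite !mulrNN -!scalerAl -!scalerAr ocb !scalerA mulrC.
  by [].
- change (oa * od - q^-1 *: (- (q^-1 *: oc) * - (q *: ob)) = 1).
  rewrite mulrNN -scalerAl -scalerAr ocb (scalerA q^-1 q) mulVf // scale1r.
  by rewrite oad addrK.
- change (od * oa - q *: (- (q^-1 *: oc) * - (q *: ob)) = 1).
  rewrite mulrNN -scalerAl -scalerAr ocb (scalerA q^-1 q) mulVf // scale1r.
  by rewrite oda addrK.
Qed.

Lemma osl2_antipode_alg : alg_morphism (osl2_antipode : Oq -> Oq^c).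
Proof. exact/plift_alg_morphism/osl2_antipode_rel. Qed.

End WellDefined.
End QuantumSL2.

Section Sweedler.
Variables (K : fieldType) (A : augAlgType K) (U : lmodType K).
Variable Delta : A -> tensor A A.

(* F(x_(1), x_(2)) *)
Definition sweedler2 (F : A -> A -> U) (x : A) : U := tensor_lift F (Delta x).

(* F(x_(1), x_(2), x_(3)), from (Delta (x) id) (Delta x) *)
Definition sweedler3 (F : A -> A -> A -> U) (x : A) : U :=
  sweedler2 (fun x12 x3 => sweedler2 (fun x1 x2 => F x1 x2 x3) x12) x.

End Sweedler.

Section HopfPairing.
Variables (K : fieldType) (q : K).
Local Notation H := (Uq q).
Local Notation C := (Oq q).

Definition pairing_gen (g : osl2_gen) (g' : usl2_gen) : K^o :=
  match g, g' with
  | ga, gK => q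
  | ga, gKinv => q^-1
  | gd, gK => q^-1
  | gd, gKinv => q
  | gb, gE => 1
  | gc, gF => 1
  | _, _ => 0
  end.

Record hopf_pairing (phi : C -> H -> K^o) : Prop := HopfPairing {
  pairing_bilinear : bilinear_map phi;
  pairingMr : forall c h h', phi c (h * h') =
    sweedler2 (@osl2_coproduct K q) (fun c1 c2 => phi c1 h * phi c2 h' : K^o) c;
  pairingMl : forall c c' h, phi (c * c') h =
    sweedler2 (@usl2_coproduct K q) (fun h1 h2 => phi c h1 * phi c' h2 : K^o) h;
  pairing1l : forall h, phi 1 h = counit h;
  pairing1r : forall c, phi c 1 = counit c;
  pairingS : forall c h, phi (osl2_antipode c) h = phi c (usl2_antipode h);
  pairing_genE : forall g g',
    phi (pgen (osl2_pres q) g) (pgen (usl2_pres q) g') = pairing_gen g g'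
}.

Variable phi : C -> H -> K^o.

(* The underlying space of the quantum double D(H); the pure tensor
   tens c h is the element c.h of D(H). *)
Definition qdouble : lmodType K := tensor C H.

(* h.c = phi(c_(1), S h_(1)) phi(c_(3), h_(3)) c_(2).h_(2) *)
Definition qdouble_cross (h : H) (c : C) : qdouble :=
  sweedler3 (@osl2_coproduct K q) (fun c1 c2 c3 =>
    sweedler3 (@usl2_coproduct K q) (fun h1 h2 h3 =>
      (phi c1 (usl2_antipode h1) * phi c3 h3) *: (tens c2 h2 : qdouble)) h) c.

(* (c.h)(c'.h') = c.(h.c').h'; the product of c and c'' in D(H) is that of
   the opposite algebra of C, that is, c'' * c in C. *)
Definition qdouble_mul (x y : qdouble) : qdouble :=
  tensor_lift (fun c h =>
    tensor_lift (fun c' h' =>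
      tensor_lift (fun c'' h'' => tens (c'' * c) (h'' * h') : qdouble)
        (qdouble_cross h c')) y) x.

Definition qdouble_dual : set (qdouble -> K^o) := [set f | linear f]%classic.

Definition qdouble_lact (x : qdouble) (f : qdouble -> K^o) : qdouble -> K^o :=
  fun y => f (qdouble_mul y x).
Definition qdouble_ract (x : qdouble) (f : qdouble -> K^o) : qdouble -> K^o :=
  fun y => f (qdouble_mul x y).

Definition qdouble_of_U (h : H) : qdouble := tens 1 h.

(* The embedding of H (x) C in D(H)^*. *)
Definition dual_of_tensor (x : tensor H C) : qdouble -> K^o :=
  fun y => tensor_lift (fun h' c' =>
    tensor_lift (fun c h => phi c h' * phi c' h : K^o) y) x.

End HopfPairing.

Section LocallyFinite.
Variables (K : fieldType) (M : lmodType K) (D : set M).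

Definition finite_dim (N : set M) :=
  exists s : seq M, (forall i : 'I_(size s), N s`_i) /\
    forall f, N f -> exists c : 'I_(size s) -> K,
      f = \sum_(i < size s) c i *: s`_i.

Variables (X : Type) (lact ract : X -> M -> M).

Record sub_bimodule (N : set M) : Prop := SubBimodule {
  sub_bimodule_sub : (N `<=` D)%classic;
  sub_bimodule0 : N 0;
  sub_bimoduleP : forall c f g, N f -> N g -> N (c *: f + g);
  sub_bimodule_lact : forall x f, N f -> N (lact x f);
  sub_bimodule_ract : forall x f, N f -> N (ract x f)
}.

(* The sub-bimodule of D generated by f is finite-dimensional. *)
Definition locally_finite (f : M) :=
  finite_dim (smallest sub_bimodule [set f]%classic).

End LocallyFinite.

Section DoubleLocallyFinite.
Variables (K : fieldType) (q : K) (phi : Oq q -> Uq q -> K^o).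

Definition qdouble_locally_finite (f : qdouble q -> K^o) :=
  locally_finite (qdouble_dual (q := q))
    (qdouble_lact phi) (qdouble_ract phi) f.

Definition usl2_locally_finite (f : qdouble q -> K^o) :=
  locally_finite (qdouble_dual (q := q))
    (fun h => qdouble_lact phi (qdouble_of_U h))
    (fun h => qdouble_ract phi (qdouble_of_U h)) f.

End DoubleLocallyFinite.

Section Linearity.
Variables (K : fieldType) (A : augAlgType K) (U : lmodType K).
Variable Delta : A -> tensor A A.

Lemma sweedler2_linear (F : A -> A -> U) :
  linear Delta -> bilinear_map F -> linear (sweedler2 Delta F).
Proof.
move=> lD bF c x y; rewrite /sweedler2 lD.
exact: (tensor_lift_linear bF).
Qed.

Lemma sweedler2_param (X : lmodType K) (F : X -> A -> A -> U) x :
    (forall x1 x2, linear (fun p => F p x1 x2)) ->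
  linear (fun p => sweedler2 Delta (F p) x).
Proof. by move=> lF; apply: tensor_lift_param. Qed.

Lemma sweedler3_linear (F : A -> A -> A -> U) :
    linear Delta -> (forall x3, bilinear_map (fun x1 x2 => F x1 x2 x3)) ->
    (forall x1 x2, linear (F x1 x2)) ->
  linear (sweedler3 Delta F).
Proof.
move=> lD bF lF; apply: sweedler2_linear => //; split=> [x3|x12].
  exact: sweedler2_linear.
exact: sweedler2_param.
Qed.

Lemma sweedler3_param (X : lmodType K) (F : X -> A -> A -> A -> U) x :
    (forall x1 x2 x3, linear (fun p => F p x1 x2 x3)) ->
  linear (fun p => sweedler3 Delta (F p) x).
Proof.
move=> lF; apply: sweedler2_param => x12 x3.
by apply: sweedler2_param => x1 x2; apply: lF.
Qed.

End Linearity.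

Lemma scaleoA (K : comNzRingType) (V : lmodType K) (k : K) (r : K^o) (v : V) :
  (k *: r) *: v = k *: (r *: v).
Proof. by rewrite scalerA. Qed.

Section Counits.
Variables (K : fieldType).

Lemma tensor_lift_comp (V W U U' : lmodType K) (b : V -> W -> U) (g : U -> U')
    (x : tensor V W) : linear g ->
  g (tensor_lift b x) = tensor_lift (fun v w => g (b v w)) x.
Proof.
move=> lg; have g0 : g 0 = 0.
  by have := lg (-1) 0 0; rewrite !scaleN1r !addNr.
rewrite /tensor_lift; elim: (repr x : tterm V W) => //= [s <- t <-|c s <-].
  by rewrite -[X in g (X + _)]scale1r lg scale1r.
by rewrite -[X in g X]addr0 lg g0 addr0.
Qed.

Lemma eq_tensor_lift (V W U : lmodType K) (b b' : V -> W -> U) :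
  (forall v w, b v w = b' v w) -> tensor_lift b =1 tensor_lift b'.
Proof.
move=> eb x; rewrite /tensor_lift.
by elim: (repr x : tterm V W) => //= [s -> t ->|c s ->].
Qed.

Lemma alg_morphism_eq (I : Type) (P : presentation K I) (A : algType K)
    (f g : palg P -> A) : alg_morphism f -> alg_morphism g ->
  (forall i, f (pgen P i) = g (pgen P i)) -> f =1 g.
Proof.
move=> [lf [f1 fM]] [lg [g1 gM]] fg.
have f0 : f 0 = 0 by have := lf (-1) 0 0; rewrite !scaleN1r !addNr.
have g0 : g 0 = 0 by have := lg (-1) 0 0; rewrite !scaleN1r !addNr.
elim/palg_ind => [i||x y IHx IHy|x y IHx IHy|c x IH] //.
- by rewrite f1 g1.
- by rewrite -[x]scale1r lf lg IHx IHy.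
- by rewrite fM gM IHx IHy.
- by rewrite -[_ *: _]addr0 lf lg f0 g0 IH.
Qed.

Lemma counitM (A : augAlgType K) (x y : A) :
  counit (x * y) = counit x * counit y.
Proof. exact: (@counit_alg_morphism K A).2.2. Qed.

Variable A : augAlgType K.

Fact counitl_bilinear : bilinear_map (fun x1 x2 : A => counit x1 *: x2).
Proof.
split=> [x2|x1] k x y /=.
  by rewrite (@counit_alg_morphism K A).1 scalerDl scaleoA.
by rewrite scalerDr !scalerA mulrC.
Qed.

Fact counitr_bilinear : bilinear_map (fun x1 x2 : A => counit x2 *: x1).
Proof.
split=> [x2|x1] k x y /=.
  by rewrite scalerDr !scalerA mulrC.
by rewrite (@counit_alg_morphism K A).1 scalerDl scaleoA.
Qed.

Lemma counitl_alg_morphism :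
  alg_morphism (tensor_lift (fun x1 x2 : A => counit x1 *: x2)).
Proof.
have bb := counitl_bilinear; have ll := tensor_lift_linear bb.
have tD x y : tensor_lift (fun x1 x2 : A => counit x1 *: x2) (x + y) =
    tensor_lift (fun x1 x2 : A => counit x1 *: x2) x +
    tensor_lift (fun x1 x2 : A => counit x1 *: x2) y.
  by rewrite -[x in LHS]scale1r ll scale1r.
split=> //; split.
  rewrite -tens1 (tensor_lift_tens bb).
  by rewrite (@counit_alg_morphism K A).2.1 scale1r.
elim/tensor_ind=> [a b|x x' IHx IHx'] y; last first.
  by rewrite mulrDl !tD IHx IHx' mulrDl.
elim/tensor_ind: y => [a' b'|y y' IHy IHy']; last first.
  by rewrite mulrDr !tD IHy IHy' mulrDr.
rewrite tensM !(tensor_lift_tens bb) counitM.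
by rewrite -scalerAl -scalerAr scalerA.
Qed.

Lemma counitr_alg_morphism :
  alg_morphism (tensor_lift (fun x1 x2 : A => counit x2 *: x1)).
Proof.
have bb := counitr_bilinear; have ll := tensor_lift_linear bb.
have tD x y : tensor_lift (fun x1 x2 : A => counit x2 *: x1) (x + y) =
    tensor_lift (fun x1 x2 : A => counit x2 *: x1) x +
    tensor_lift (fun x1 x2 : A => counit x2 *: x1) y.
  by rewrite -[x in LHS]scale1r ll scale1r.
split=> //; split.
  rewrite -tens1 (tensor_lift_tens bb).
  by rewrite (@counit_alg_morphism K A).2.1 scale1r.
elim/tensor_ind=> [a b|x x' IHx IHx'] y; last first.
  by rewrite mulrDl !tD IHx IHx' mulrDl.
elim/tensor_ind: y => [a' b'|y y' IHy IHy']; last first.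
  by rewrite mulrDr !tD IHy IHy' mulrDr.
rewrite tensM !(tensor_lift_tens bb) counitM.
by rewrite -scalerAl -scalerAr scalerA.
Qed.

Lemma alg_morphism_comp (B D : algType K) (f : A -> B) (g : B -> D) :
  alg_morphism f -> alg_morphism g -> alg_morphism (g \o f).
Proof.
move=> [lf [f1 fM]] [lg [g1 gM]]; split; last split.
- by move=> k x y; rewrite /= lf lg.
- by rewrite /= f1 g1.
- by move=> x y; rewrite /= fM gM.
Qed.

Variable Delta : A -> tensor A A.
Hypothesis Deltal :
  forall x, sweedler2 Delta (fun x1 x2 => counit x1 *: x2) x = x.
Hypothesis Deltar :
  forall x, sweedler2 Delta (fun x1 x2 => counit x2 *: x1) x = x.

Lemma sweedler3_counit (U : lmodType K) (G : A -> U) x : linear G ->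
  sweedler3 Delta (fun x1 x2 x3 => (counit x1 * counit x3) *: G x2) x = G x.
Proof.
move=> lG; have G0 : G 0 = 0.
  by have := lG (-1) 0 0; rewrite !scaleN1r !addNr.
have GZ c y : G (c *: y) = c *: G y by rewrite -[c *: y]addr0 lG G0 addr0.
rewrite -[in RHS](Deltar x) /sweedler3 /sweedler2 (tensor_lift_comp _ _ lG).
apply: eq_tensor_lift => x12 x3; rewrite GZ.
rewrite -[in RHS](Deltal x12) /sweedler2 (tensor_lift_comp _ _ lG).
have lZ : linear (fun u : U => counit x3 *: u).
  by move=> k u v; rewrite scalerDr !scalerA mulrC.
rewrite (tensor_lift_comp _ _ lZ); apply: eq_tensor_lift => x1 x2 /=.
by rewrite GZ scalerA mulrC.
Qed.

Lemma sweedler3_1 (U : lmodType K) (F : A -> A -> A -> U) :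
    linear Delta -> Delta 1 = 1 ->
    (forall x3, bilinear_map (fun x1 x2 => F x1 x2 x3)) ->
    (forall x1 x2, linear (F x1 x2)) ->
  sweedler3 Delta F 1 = F 1 1 1.
Proof.
move=> lD D1 bF lF; rewrite /sweedler3 {1}/sweedler2 D1 -tens1.
rewrite tensor_lift_tens; first by rewrite /sweedler2 D1 -tens1 tensor_lift_tens.
split=> [x3|x12]; first exact: sweedler2_linear.
exact: sweedler2_param.
Qed.

End Counits.

Section DoubleTheory.
Variables (K : fieldType) (q : K) (phi : Oq q -> Uq q -> K^o).
Hypotheses (q_neq0 : q != 0) (hphi : hopf_pairing phi).
Local Notation D := (qdouble q).
Let bphi := pairing_bilinear hphi.
Let lDH := (usl2_coproduct_alg q_neq0).1.
Let lDC := (osl2_coproduct_alg q_neq0).1.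
Let lSH := (usl2_antipode_alg q_neq0).1 : linear (@usl2_antipode K q).

Section CrossLinearity.
Let bt := tens_bilinear (Oq q) (Uq q).

Fact qdouble_cross_bilinearH c1 c2 c3 h3 : bilinear_map (fun h1 h2 =>
  (phi c1 (usl2_antipode h1) * phi c3 h3) *: (tens c2 h2 : D)).
Proof.
split=> [h2|h1] k x y /=.
  by rewrite lSH bphi.2 mulrDl -scalerAl scalerDl scaleoA.
by rewrite (bmDr bt) (bmZr bt) scalerDr !scalerA mulrC.
Qed.

Fact qdouble_cross_linearH c1 c2 c3 h1 h2 : linear (fun h3 =>
  (phi c1 (usl2_antipode h1) * phi c3 h3) *: (tens c2 h2 : D)).
Proof.
by move=> k x y /=; rewrite bphi.2 mulrDr -scalerAr scalerDl scaleoA.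
Qed.

Fact qdouble_cross_bilinearC h c3 : bilinear_map (fun c1 c2 =>
  sweedler3 (@usl2_coproduct K q) (fun h1 h2 h3 =>
    (phi c1 (usl2_antipode h1) * phi c3 h3) *: (tens c2 h2 : D)) h).
Proof.
split=> [c2|c1]; apply: sweedler3_param => h1 h2 h3 k x y /=.
  by rewrite bphi.1 mulrDl -scalerAl scalerDl scaleoA.
by rewrite (bmDl bt) (bmZl bt) scalerDr !scalerA mulrC.
Qed.

Fact qdouble_cross_linearC h c1 c2 : linear (fun c3 =>
  sweedler3 (@usl2_coproduct K q) (fun h1 h2 h3 =>
    (phi c1 (usl2_antipode h1) * phi c3 h3) *: (tens c2 h2 : D)) h).
Proof.
apply: sweedler3_param => h1 h2 h3 k x y /=.
by rewrite bphi.1 mulrDr -scalerAr scalerDl scaleoA.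
Qed.

Lemma qdouble_cross_bilinear : bilinear_map (qdouble_cross phi).
Proof.
split=> [c|h].
  apply: sweedler3_param => c1 c2 c3; apply: sweedler3_linear => //.
    exact: qdouble_cross_bilinearH.
  exact: qdouble_cross_linearH.
apply: sweedler3_linear => //; first exact: qdouble_cross_bilinearC.
exact: qdouble_cross_linearC.
Qed.
End CrossLinearity.

Fact qdouble_mul_bilinear3 c h' :
  bilinear_map (fun c'' h'' => tens (c'' * c) (h'' * h') : D).
Proof.
have bt := tens_bilinear (Oq q) (Uq q).
split=> [h''|c''] k x y /=.
  by rewrite mulrDl -scalerAl (bmDl bt) (bmZl bt).
by rewrite mulrDl -scalerAl (bmDr bt) (bmZr bt).
Qed.

Fact qdouble_mul_bilinear2 c h : bilinear_map (fun c' h' =>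
  tensor_lift (fun c'' h'' => tens (c'' * c) (h'' * h') : D)
    (qdouble_cross phi h c')).
Proof.
have bt := tens_bilinear (Oq q) (Uq q).
split=> [h'|c'].
  move=> k x y; rewrite qdouble_cross_bilinear.2.
  exact: (tensor_lift_linear (qdouble_mul_bilinear3 c h')).
apply: tensor_lift_param => c'' h'' k x y /=.
by rewrite mulrDr -scalerAr (bmDr bt) (bmZr bt).
Qed.

Fact qdouble_mul_bilinear1 (y : D) : bilinear_map (fun c h =>
  tensor_lift (fun c' h' =>
    tensor_lift (fun c'' h'' => tens (c'' * c) (h'' * h') : D)
      (qdouble_cross phi h c')) y).
Proof.
have bt := tens_bilinear (Oq q) (Uq q).
split=> [h|c]; apply: tensor_lift_param => c' h'.
  apply: tensor_lift_param => c'' h'' k x z /=.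
  by rewrite mulrDr -scalerAr (bmDl bt) (bmZl bt).
move=> k x z; rewrite qdouble_cross_bilinear.1.
exact: (tensor_lift_linear (qdouble_mul_bilinear3 c h')).
Qed.

Lemma qdouble_mul_bilinear : bilinear_map (qdouble_mul phi).
Proof.
split=> [y|x]; first exact: (tensor_lift_linear (qdouble_mul_bilinear1 y)).
apply: tensor_lift_param => c h.
exact: (tensor_lift_linear (qdouble_mul_bilinear2 c h)).
Qed.

Lemma qdouble_mul_tens c h c' h' : qdouble_mul phi (tens c h) (tens c' h') =
  tensor_lift (fun c'' h'' => tens (c'' * c) (h'' * h') : D)
    (qdouble_cross phi h c').
Proof.
rewrite /qdouble_mul (tensor_lift_tens (qdouble_mul_bilinear1 _)).
exact: (tensor_lift_tens (qdouble_mul_bilinear2 _ _)).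
Qed.

Local Notation DH := (@usl2_coproduct K q).
Local Notation DC := (@osl2_coproduct K q).

Lemma usl2_coproduct_gen g : DH (pgen (usl2_pres q) g) = match g with
  | gK => tens (uK q) (uK q)
  | gKinv => tens (uKinv q) (uKinv q)
  | gE => tens (uE q) (uK q) + tens 1 (uE q)
  | gF => tens (uF q) 1 + tens (uKinv q) (uF q)
  end.
Proof. exact/plift_gen/usl2_coproduct_rel. Qed.

Lemma osl2_coproduct_gen g : DC (pgen (osl2_pres q) g) = match g with
  | ga => tens (oa q) (oa q) + tens (ob q) (oc q)
  | gb => tens (oa q) (ob q) + tens (ob q) (od q)
  | gc => tens (oc q) (oa q) + tens (od q) (oc q)
  | gd => tens (oc q) (ob q) + tens (od q) (od q)
  end.
Proof. exact/plift_gen/osl2_coproduct_rel. Qed.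

Lemma usl2_antipode_gen g :
  usl2_antipode (pgen (usl2_pres q) g) = usl2_antipode_on q g.
Proof.
exact (plift_gen (P := usl2_pres q) (A := (Uq q)^c)
  (usl2_antipode_rel q_neq0) g).
Qed.

Let idm (A : algType K) : alg_morphism (@id A).
Proof. by split=> //; split. Qed.

Let lD (V : lmodType K) (W : lmodType K) (f : V -> W) x y :
  linear f -> f (x + y) = f x + f y.
Proof. by move=> lf; rewrite -[x in LHS]scale1r lf scale1r. Qed.

Lemma usl2_counitl x : sweedler2 DH (fun x1 x2 => counit x1 *: x2) x = x.
Proof.
have bb := counitl_bilinear (Uq q).
apply: (alg_morphism_eq (alg_morphism_comp (usl2_coproduct_alg q_neq0)
  (counitl_alg_morphism _)) (idm _)) => -[] /=; rewrite usl2_coproduct_gen;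
rewrite ?(lD _ _ (tensor_lift_linear bb)) !(tensor_lift_tens bb);
by rewrite ?counit_gen ?(@counit_alg_morphism K _).2 ?scale1r ?scale0r
  ?add0r ?addr0.
Qed.

Lemma usl2_counitr x : sweedler2 DH (fun x1 x2 => counit x2 *: x1) x = x.
Proof.
have bb := counitr_bilinear (Uq q).
apply: (alg_morphism_eq (alg_morphism_comp (usl2_coproduct_alg q_neq0)
  (counitr_alg_morphism _)) (idm _)) => -[] /=; rewrite usl2_coproduct_gen;
rewrite ?(lD _ _ (tensor_lift_linear bb)) !(tensor_lift_tens bb);
by rewrite ?counit_gen ?(@counit_alg_morphism K _).2 ?scale1r ?scale0r
  ?add0r ?addr0.
Qed.

Lemma osl2_counitl x : sweedler2 DC (fun x1 x2 => counit x1 *: x2) x = x.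
Proof.
have bb := counitl_bilinear (Oq q).
apply: (alg_morphism_eq (alg_morphism_comp (osl2_coproduct_alg q_neq0)
  (counitl_alg_morphism _)) (idm _)) => -[] /=; rewrite osl2_coproduct_gen;
rewrite ?(lD _ _ (tensor_lift_linear bb)) !(tensor_lift_tens bb);
by rewrite ?counit_gen ?(@counit_alg_morphism K _).2 ?scale1r ?scale0r
  ?add0r ?addr0.
Qed.

Lemma osl2_counitr x : sweedler2 DC (fun x1 x2 => counit x2 *: x1) x = x.
Proof.
have bb := counitr_bilinear (Oq q).
apply: (alg_morphism_eq (alg_morphism_comp (osl2_coproduct_alg q_neq0)
  (counitr_alg_morphism _)) (idm _)) => -[] /=; rewrite osl2_coproduct_gen;
rewrite ?(lD _ _ (tensor_lift_linear bb)) !(tensor_lift_tens bb);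
by rewrite ?counit_gen ?(@counit_alg_morphism K _).2 ?scale1r ?scale0r
  ?add0r ?addr0.
Qed.

Lemma usl2_counit_antipode (x : Uq q) : counit (usl2_antipode x) = counit x.
Proof.
have cm := @counit_alg_morphism K (Uq q).
apply: (alg_morphism_eq (P := usl2_pres q) (A := K^o)
  (f := fun x => counit (usl2_antipode x)) (g := counit) _ cm) => [|g].
  have [lS [S1 SM]] := usl2_antipode_alg q_neq0.
  split=> [k u v|]; first by rewrite lS cm.1.
  split=> [|u v]; first by rewrite S1 cm.2.1.
  by rewrite SM (cm.2.2 (usl2_antipode v)) mulrC.
have c0 : counit (0 : Uq q) = 0.
  by have := cm.1 (-1) 0 0; rewrite !scaleN1r !addNr.
have cN u : counit (- u : Uq q) = - counit u.
  by have := cm.1 (-1) u 0; rewrite addr0 c0 addr0 !scaleN1r.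
rewrite usl2_antipode_gen; case: g => /=; rewrite ?cN ?cm.2.2 !counit_gen //=.
- by rewrite mul0r oppr0.
- by rewrite mulr0 oppr0.
Qed.

Lemma qdouble_cross1r h : qdouble_cross phi h 1 = tens 1 h.
Proof.
rewrite /qdouble_cross sweedler3_1 //.
- rewrite -[RHS](sweedler3_counit usl2_counitl usl2_counitr _
    ((tens_bilinear (Oq q) (Uq q)).2 1)).
  apply: eq_tensor_lift => x12 x3; apply: eq_tensor_lift => x1 x2.
  by rewrite !(pairing1l hphi) usl2_counit_antipode.
- exact: (osl2_coproduct_alg q_neq0).2.1.
- move=> c3; exact: (qdouble_cross_bilinearC h c3).
- move=> c1 c2; exact: (qdouble_cross_linearC h c1 c2).
Qed.

Lemma qdouble_cross1l c : qdouble_cross phi 1 c = tens c 1.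
Proof.
have S1 : usl2_antipode 1 = 1 :> Uq q := (usl2_antipode_alg q_neq0).2.1.
rewrite /qdouble_cross -[RHS](sweedler3_counit osl2_counitl osl2_counitr _
  ((tens_bilinear (Oq q) (Uq q)).1 1)).
apply: eq_tensor_lift => x12 x3; apply: eq_tensor_lift => x1 x2.
rewrite sweedler3_1 //.
- by rewrite S1 !(pairing1r hphi).
- exact: (usl2_coproduct_alg q_neq0).2.1.
- move=> h3; exact: (qdouble_cross_bilinearH x1 x2 x3 h3).
- move=> h1 h2; exact: (qdouble_cross_linearH x1 x2 x3 h1 h2).
Qed.

Lemma qdouble_mul_op c c' :
  qdouble_mul phi (tens c 1) (tens c' 1) = tens (c' * c) 1.
Proof.
rewrite qdouble_mul_tens qdouble_cross1l.
by rewrite (tensor_lift_tens (qdouble_mul_bilinear3 _ _)) mulr1.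
Qed.

Lemma qdouble_mul_U h h' :
  qdouble_mul phi (tens 1 h) (tens 1 h') = tens 1 (h * h').
Proof.
rewrite qdouble_mul_tens qdouble_cross1r.
by rewrite (tensor_lift_tens (qdouble_mul_bilinear3 _ _)) mulr1.
Qed.

Lemma qdouble_mul_opU c h : qdouble_mul phi (tens c 1) (tens 1 h) = tens c h.
Proof.
rewrite qdouble_mul_tens qdouble_cross1l.
by rewrite (tensor_lift_tens (qdouble_mul_bilinear3 _ _)) mul1r mul1r.
Qed.

Lemma qdouble_mul_cross h c :
  qdouble_mul phi (tens 1 h) (tens c 1) = qdouble_cross phi h c.
Proof.
rewrite qdouble_mul_tens.
elim/tensor_ind: (qdouble_cross phi h c) => [c' h'|x y IHx IHy].
  by rewrite (tensor_lift_tens (qdouble_mul_bilinear3 _ _)) !mulr1.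
by rewrite (lD _ _ (tensor_lift_linear (qdouble_mul_bilinear3 _ _))) IHx IHy.
Qed.

Lemma qdouble_lact_dual x f :
  qdouble_dual f -> qdouble_dual (qdouble_lact phi x f).
Proof.
by move=> lf k y z; rewrite /qdouble_lact qdouble_mul_bilinear.1 lf.
Qed.

Lemma qdouble_ract_dual x f :
  qdouble_dual f -> qdouble_dual (qdouble_ract phi x f).
Proof.
by move=> lf k y z; rewrite /qdouble_ract qdouble_mul_bilinear.2 lf.
Qed.

Lemma dual_of_tensor_dual x : qdouble_dual (dual_of_tensor phi x).
Proof.
apply: (@tensor_lift_param _ _ _ _ _ (fun y h' c' => tensor_lift
  (fun c h => phi c h' * phi c' h : K^o) y)) => h' c'.
apply: tensor_lift_linear; split=> [h|c] k y z /=.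
  by rewrite bphi.1 mulrDl -scalerAl.
by rewrite bphi.2 mulrDr -scalerAr.
Qed.

Lemma qdouble_dual_sub_bimodule :
  sub_bimodule (@qdouble_dual K q) (qdouble_lact phi) (qdouble_ract phi)
    (@qdouble_dual K q).
Proof.
split=> //.
- move=> k x y; change (0 = k *: 0 + 0 :> K^o).
  by rewrite scaler0 addr0.
- move=> k f g lf lg c x y.
  change (k *: f (c *: x + y) + g (c *: x + y) =
    c *: (k *: f x + g x) + (k *: f y + g y)).
  by rewrite lf lg !scalerDr !scalerA (mulrC c) addrACA.
- exact: qdouble_lact_dual.
- exact: qdouble_ract_dual.
Qed.

End DoubleTheory.

(* The field C(q), where C is R[i] for a realType R. *)
Definition Cq (R : realType) : fieldType := {fraction {poly R[i]}}.
Definition qvar (R : realType) : Cq R := tofrac 'X.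

Lemma qvar_neq0 (R : realType) : qvar R != 0.
Proof. by rewrite tofrac_eq0 polyX_eq0. Qed.

(* Main.v *)
Require Import Defs.
From HB Require Import structures.
From mathcomp Require Import all_boot all_algebra.
From mathcomp Require Import boolp classical_sets functions reals complex.

(** Write [D] for the quantum double [C.H], and [R_y f = f (y _)],
[L_x f = f (_ x)] for the right and left actions on its dual.

A sub-bimodule for [D] is one for [H], so local finiteness under [D] implies
local finiteness under [H].

For the converse, let [f] be the functional of an element of [H (x) C].
- Each [R_h f] with [h] in [H] is again the functional of an element of
  [H (x) C] ([ract_U_dual]), because [h] acts by
  [h' (x) c' |-> S(h_1) h' h_3 (x) phi(c'_1, h_2) c'_2].
- On such functionals the algebra [C] acts from the right through the coproduct
  of [H], by [h' (x) c' |-> h'_1 phi(c, h'_2) (x) c'], and this action is always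
  locally finite ([ract_O_spanned]).
- [D] is spanned by the products [h.c] as well as by the [c.h]
  ([qdouble_reorder]), and [R_{hc} f = R_c R_h f]. So if the [R_h f] span a
  finite-dimensional space, then all the [R_y f], with [y] in [D], do
  ([ract_orbit_spanned]).
- The functions [L_x f] are the rows of the matrix [f (y x)] whose columns are
  the [R_y f]: if the columns span a finite-dimensional space, so do the rows
  ([spanned_transpose]). Applied to each member of a finite family generating
  the span of the [R_y f], this bounds the dimension of the span of all
  [L_x R_y f] ([bimodule_orbit_spanned]), which is the sub-bimodule generated
  by [f].

The argument uses that the product of [D] is associative ([qdouble_mulA]). To
compute in [D], [H] and [C] are spanned by entries of comatrices, that is,
square matrices [M] with [Delta (M i j) = sum_k M i k (x) M k j] and
[eps (M i j) = delta_ij]. On their entries every iterated coproduct is an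
explicit finite sum, the pairing becomes a matrix product, and the
cross-relation conjugates a comatrix of [C] by scalar matrices. *)

Set Implicit Arguments.
Unset Strict Implicit.
Unset Printing Implicit Defensive.

Import GRing.Theory.
Local Open Scope ring_scope.

(** * Spans of finite families *)

Section Spans.
Variables (K : fieldType) (M : lmodType K).
Implicit Types (s t : seq M) (f g v : M) (N : set M).

(** Membership in the linear span of [s]. The recursive form suits inductions
on [s] better than an indexed family of coefficients. *)
Fixpoint spanned s f : Prop :=
  if s is v :: s' then exists c : K, spanned s' (f - c *: v) else f = 0.

Lemma spanned0 s : spanned s 0.
Proof. by elim: s => //= v s IHs; exists 0; rewrite scale0r subr0. Qed.

Lemma spannedP s c f g : spanned s f -> spanned s g -> spanned s (c *: f + g).
Proof.
elim: s f g => [|v s IHs] f g /=; first by move=> -> ->; rewrite scaler0 addr0.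
move=> [a sf] [b sg]; exists (c * a + b).
by rewrite scalerDl -scalerA opprD addrACA -scalerBr; apply: IHs.
Qed.

Lemma spannedD s f g : spanned s f -> spanned s g -> spanned s (f + g).
Proof. by move=> sf sg; rewrite -[f]scale1r; apply: spannedP. Qed.

Lemma spannedZ s c f : spanned s f -> spanned s (c *: f).
Proof. by move=> sf; rewrite -[_ *: _]addr0; apply/spannedP/spanned0. Qed.

Lemma spanned_catl s t f : spanned s f -> spanned (s ++ t) f.
Proof.
elim: s f => [|v s IHs] f /=; first by move=> ->; apply: spanned0.
by move=> [c /IHs]; exists c.
Qed.

Lemma spanned_catr s t f : spanned t f -> spanned (s ++ t) f.
Proof.
move=> tf; elim: s => //= v s IHs; exists 0.
by rewrite scale0r subr0.
Qed.

Lemma spanned_lincomb s (c : 'I_(size s) -> K) :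
  spanned s (\sum_(i < size s) c i *: s`_i).
Proof.
elim: s c => [|v s IHs] c /=; first by rewrite big_ord0.
by exists (c ord0); rewrite big_ord_recl addrC addKr.
Qed.

Lemma spanned_sum s (I : finType) (F : I -> M) :
  (forall i, spanned s (F i)) -> spanned s (\sum_i F i).
Proof.
by move=> sF; elim/big_ind: _ => //; [apply: spanned0 | apply: spannedD].
Qed.

Lemma spanned_family (I : finType) (c : I -> K) (F : I -> M) :
  spanned [seq F i | i <- enum I] (\sum_i c i *: F i).
Proof.
rewrite -big_enum /=; elim: (enum I) => [|i e IHe] /=; first by rewrite big_nil.
by exists (c i); rewrite big_cons addrC addrK.
Qed.

(** Finitely many bounds, one for each generator, combine into a single bound
that is uniform in the operator and in the vector. *)
Lemma spanned_uniform (X : Type) (F : X -> M -> M) s :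
    (forall x c f g, F x (c *: f + g) = c *: F x f + F x g) ->
    (forall i : 'I_(size s), exists t, forall x, spanned t (F x s`_i)) ->
  exists t, forall x f, spanned s f -> spanned t (F x f).
Proof.
move=> lF; elim: s => [|v s IHs] Fs /=.
  exists [::] => x f -> /=.
  by have := lF x (-1) 0 0; rewrite !scaleN1r !addNr.
have [t tP] := Fs ord0.
have [i|t' t'P] := IHs; first exact: (Fs (lift ord0 i)).
exists (t ++ t') => x f [c sf]; rewrite -[f](subrKC (c *: v)) lF.
apply: spannedP; first exact/spanned_catl/tP.
exact/spanned_catr/t'P.
Qed.

(** A family that witnesses [finite_dim N] has its members in [N], unlike [s].
It is found by induction on [s]: if some [n] in [N] has a nonzero coefficient on
the first generator, then [n] completes a family for the members of [N] in the
span of the other generators. *)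
Lemma finite_dim_sub N s :
    N 0 -> (forall c f g, N f -> N g -> N (c *: f + g)) ->
    (forall f, N f -> spanned s f) ->
  finite_dim N.
Proof.
elim: s N => [|v s IHs] N N0 NP Ns.
  exists [::]; split=> [[]//|f /Ns ->].
  by exists (fun=> 0); rewrite big_ord0.
have [||f [] //|t [tN tP]] := IHs (fun f => N f /\ spanned s f).
- by split=> //; apply: spanned0.
- by move=> c f g [Nf sf] [Ng sg]; split; [apply: NP | apply: spannedP].
have [[n [c [Nn c0 sn]]]|noN] :=
  pselect (exists n c, [/\ N n, c != 0 & spanned s (n - c *: v)]).
  exists (n :: t); split=> [[[|i] lti] //|f Nf].
    by have [] := tN (Ordinal (lti : (i < size t)%N)).
  have [b sf] := Ns _ Nf.
  have [|a fa] := tP (- (b / c) *: n + f).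
    split; first exact: NP.
    suff -> : - (b / c) *: n + f = - (b / c) *: (n - c *: v) + (f - b *: v).
      exact: spannedP.
    rewrite scalerBr scalerA mulNr divfK // (scaleNr b) opprK.
    by rewrite addrACA subrr addr0.
  exists (fun i => oapp a (b / c) (unlift ord0 i)).
  rewrite big_ord_recl /= unlift_none /=.
  under eq_bigr do rewrite liftK /=.
  by rewrite -fa addrA -scalerDl subrr scale0r add0r.
exists t; split=> [i|f Nf]; first by have [] := tN i.
apply: tP; split=> //; have [b] := Ns _ Nf.
have [-> |b0 sf] := eqVneq b 0; first by rewrite scale0r subr0.
by case: noN; exists f, b.
Qed.

End Spans.

(** The row space of a matrix, possibly infinite, is finite-dimensional when its
column space is: writing [B y = sum_i c_i(y) s_i], the functions [c_i] generate
the functions [B _ x]. *)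
Lemma spanned_transpose (K : fieldType) (X Y : Type) (s : seq (X -> K^o))
    (B : Y -> X -> K^o) :
    (forall y, spanned s (B y)) ->
  exists t : seq (Y -> K^o), forall x, spanned t (fun y => B y x).
Proof.
elim: s B => [|v s IHs] B sB.
  by exists [::] => x /=; apply/funext => y; rewrite (sB y).
have [c cP] := choice sB.
have [t tP] := IHs _ cP.
exists (c :: t) => x /=; exists (v x).
suff -> : (fun y => B y x) - v x *: (c : Y -> K^o) = fun y => (B y - c y *: v) x.
  exact: tP.
apply/funext => y; change (B y x - v x * c y = B y x - c y * v x).
by rewrite mulrC.
Qed.

Lemma lincomb_fctE (K : fieldType) (X : Type) (I : finType) (a : I -> K)
    (f : I -> X -> K^o) y :
  (\sum_i a i *: f i) y = \sum_i a i *: f i y.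
Proof. by rewrite fct_sumE. Qed.

(** * Generated sub-bimodules *)

Section SubBimodules.
Variables (K : fieldType) (M : lmodType K) (D : set M) (X : Type).
Variables (lact ract : X -> M -> M).

(** The intersection defining the generated sub-bimodule must have a member, for
its elements to lie in [D]; [N] is that member. *)
Lemma sub_bimodule_smallest f N : sub_bimodule D lact ract N -> N f ->
  sub_bimodule D lact ract (smallest (sub_bimodule D lact ract) [set f]%classic).
Proof.
move=> bN Nf; split.
- move=> g sg; apply: (sub_bimodule_sub bN); apply: sg.
  by split=> // _ ->.
- by move=> B [bB _]; apply: (sub_bimodule0 bB).
- move=> c g h sg sh B BP; have [bB _] := BP.
  by apply: (sub_bimoduleP bB); [apply: sg | apply: sh].
- move=> x g sg B BP; have [bB _] := BP.
  by apply: (sub_bimodule_lact bB); apply: sg.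
- move=> x g sg B BP; have [bB _] := BP.
  by apply: (sub_bimodule_ract bB); apply: sg.
Qed.

Lemma locally_finite_spanned f N s : sub_bimodule D lact ract N -> N f ->
    (forall g, smallest (sub_bimodule D lact ract) [set f]%classic g ->
      spanned s g) ->
  locally_finite D lact ract f.
Proof.
move=> bN Nf sP; have bS := sub_bimodule_smallest bN Nf.
by apply: (finite_dim_sub (s := s)) sP; [case: bS | case: bS].
Qed.

Lemma finite_dim_spanned N : finite_dim N ->
  exists s : seq M, forall f : M, N f -> spanned s f.
Proof.
move=> [s [_ sP]]; exists s => f /sP[c ->]; exact: spanned_lincomb.
Qed.

End SubBimodules.

(** * Comatrices *)

Lemma linear_morphD (K : nzRingType) (V W : lmodType K) (f : V -> W) :
  linear f -> {morph f : x y / x + y}.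
Proof. by move=> lf x y; rewrite -[x in LHS]scale1r lf scale1r. Qed.

Lemma linear_morph0 (K : nzRingType) (V W : lmodType K) (f : V -> W) :
  linear f -> f 0 = 0.
Proof. by move=> lf; have := lf (-1) 0 0; rewrite !scaleN1r !addNr. Qed.

Lemma linear_morphZ (K : nzRingType) (V W : lmodType K) (f : V -> W) :
  linear f -> forall c x, f (c *: x) = c *: f x.
Proof. by move=> lf c x; rewrite -[_ *: x]addr0 lf linear_morph0 // addr0. Qed.

Lemma linear_morph_sum (K : nzRingType) (V W : lmodType K) (f : V -> W)
    (I : finType) (F : I -> V) :
  linear f -> f (\sum_i F i) = \sum_i f (F i).
Proof.
move=> lf; apply: big_morph; [exact: linear_morphD | exact: linear_morph0].
Qed.

Section Comatrices.
Variables (K : fieldType) (A : augAlgType K) (Delta : A -> tensor A A).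
Implicit Types I J : finType.

Definition comatrix I (M : I -> I -> A) := forall i j,
  Delta (M i j) = \sum_k tens (M i k) (M k j) /\ counit (M i j) = (i == j)%:R.

(** The tensor product of two comatrices, with entries multiplied in [A]. *)
Definition kronecker I J (M : I -> I -> A) (N : J -> J -> A) (u v : I * J) :=
  M u.1 v.1 * N u.2 v.2.

Lemma sum_delta I (V : lmodType K) (F : I -> V) i :
  \sum_j (i == j)%:R *: F j = F i.
Proof.
rewrite (bigD1 i) //= eqxx scale1r big1 ?addr0 // => j ji.
by rewrite eq_sym (negbTE ji) scale0r.
Qed.

Lemma comatrix1 : alg_morphism Delta -> comatrix (fun _ _ : unit => 1 : A).
Proof.
move=> [_ [D1 _]] [] [].
by rewrite (big_pred1 tt) => [|[]//]; rewrite D1 (@counit_alg_morphism K A).2.1.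
Qed.

Lemma comatrixM I J (M : I -> I -> A) (N : J -> J -> A) :
  alg_morphism Delta -> comatrix M -> comatrix N -> comatrix (kronecker M N).
Proof.
move=> [_ [_ DM]] cM cN [i i'] [j j']; rewrite /kronecker /=; split.
  rewrite DM (cM _ _).1 (cN _ _).1 big_distrlr /= pair_bigA /=.
  by apply: eq_bigr => -[k k'] _; rewrite tensM.
rewrite counitM (cM _ _).2 (cN _ _).2 xpair_eqE.
by case: (i == j); rewrite ?mul1r ?mul0r.
Qed.

Lemma sweedler2_comatrix (U : lmodType K) (F : A -> A -> U) I (M : I -> I -> A)
    i j : bilinear_map F -> comatrix M ->
  sweedler2 Delta F (M i j) = \sum_k F (M i k) (M k j).
Proof.
move=> bF cM; rewrite /sweedler2 (cM i j).1
  (linear_morph_sum _ (tensor_lift_linear bF)).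
by apply: eq_bigr => k _; rewrite tensor_lift_tens.
Qed.

Lemma sweedler3_comatrix (U : lmodType K) (F : A -> A -> A -> U) I
    (M : I -> I -> A) i j : linear Delta ->
    (forall x3, bilinear_map (fun x1 x2 => F x1 x2 x3)) ->
    (forall x1 x2, linear (F x1 x2)) -> comatrix M ->
  sweedler3 Delta F (M i j) = \sum_k \sum_l F (M i k) (M k l) (M l j).
Proof.
move=> lD bF lF cM; rewrite /sweedler3 sweedler2_comatrix //.
  rewrite exchange_big /=; apply: eq_bigr => l _.
  by rewrite sweedler2_comatrix.
by split=> [x3|x12]; [apply: sweedler2_linear | apply: sweedler2_param].
Qed.

End Comatrices.

(** A presented algebra is spanned by the entries of a class of matrices that is
stable under Kronecker products and whose entries include [1] and the
generators: products of entries are entries of Kronecker products. *)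
Lemma palg_entries (K : fieldType) (X : Type) (P : presentation K X)
    (good : forall I : finType, (I -> I -> palg P) -> Prop) :
    good unit (fun _ _ => 1) ->
    (forall (I J : finType) (M : I -> I -> palg P) (N : J -> J -> palg P),
      good I M -> good J N -> good (I * J)%type (kronecker M N)) ->
    (forall g, exists (I : finType) (M : I -> I -> palg P) i j,
      good I M /\ M i j = pgen P g) ->
  forall (Q : palg P -> Prop),
    (forall c x y, Q x -> Q y -> Q (c *: x + y)) ->
    (forall (I : finType) (M : I -> I -> palg P) i j, good I M -> Q (M i j)) ->
  forall x, Q x.
Proof.
move=> g1 gM gG Q QP QM x.
(* Products require the induction hypothesis at the predicates
   fun x => Q (x * y) and fun y => Q (M i j * y), so Q is generalized. *)
elim/palg_ind: x Q QP QM => [g||x y IHx IHy|x y IHx IHy|c x IHx] Q QP QM.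
- by have [I [M [i [j [gdM <-]]]]] := gG g; apply: QM.
- exact: (QM _ _ tt tt g1).
- by rewrite -[x]scale1r; exact: (QP 1 _ _ (IHx Q QP QM) (IHy Q QP QM)).
- apply: (IHx (fun x => Q (x * y))) => [c x1 x2 Q1 Q2|I M i j gdM].
    by rewrite mulrDl -scalerAl; apply: QP.
  apply: (IHy (fun y => Q (M i j * y))) => [c y1 y2 Q1 Q2|J N i' j' gdN].
    by rewrite mulrDr -scalerAr; apply: QP.
  exact: (QM _ _ (i, i') (j, j') (gM _ _ _ _ gdM gdN)).
- rewrite -[_ *: _]addr0; apply: (QP c x 0 (IHx Q QP QM)).
  have Q1 := QM _ _ tt tt g1.
  by have := QP (-1) _ _ Q1 Q1; rewrite scaleN1r addNr.
Qed.

Definition mx2 (T : Type) (a b c d : T) (i j : bool) : T :=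
  if i then (if j then d else c) else (if j then b else a).

Section QuantumComatrices.
Variables (K : fieldType) (q : K).
Hypothesis q_neq0 : q != 0.
Local Notation C := (Oq q).
Local Notation H := (Uq q).
Local Notation DH := (@usl2_coproduct K q).
Local Notation DC := (@osl2_coproduct K q).
Local Notation S := (@usl2_antipode K q).

(** The second condition says that [S M] is a right inverse of [M]. It follows
from the antipode axiom of [H]; including it in the induction over comatrices
leaves it to be checked on the generators only. *)
Definition Hcomatrix (I : finType) (M : I -> I -> H) := comatrix DH M /\
  forall i j, \sum_k M i k * S (M k j) = (i == j)%:R.

Lemma Oq_entries (Q : C -> Prop) :
    (forall c x y, Q x -> Q y -> Q (c *: x + y)) ->
    (forall (I : finType) (T : I -> I -> C) i j, comatrix DC T -> Q (T i j)) ->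
  forall x, Q x.
Proof.
refine (@palg_entries _ _ (osl2_pres q) (fun I => @comatrix K C DC I) _ _ _ Q).
- exact/comatrix1/osl2_coproduct_alg.
- by move=> I J M N; apply/comatrixM/osl2_coproduct_alg.
pose T := mx2 (oa q) (ob q) (oc q) (od q).
have cT : comatrix DC T.
  by move=> [] []; rewrite big_bool /= osl2_coproduct_gen // counit_gen;
    split=> //; rewrite addrC.
by case; exists bool, T; [exists false, false|exists false, true
  |exists true, false|exists true, true].
Qed.

Lemma Uq_entries (Q : H -> Prop) :
    (forall c x y, Q x -> Q y -> Q (c *: x + y)) ->
    (forall (I : finType) (M : I -> I -> H) i j, Hcomatrix M -> Q (M i j)) ->
  forall x, Q x.
Proof.
have [lS [S1 SM]] := usl2_antipode_alg q_neq0.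
have S0 : S 0 = 0 := linear_morph0 lS.
have ctr0 : counit (0 : H) = 0 := linear_morph0 (@counit_alg_morphism K H).1.
have ctr1 : counit (1 : H) = 1 := (@counit_alg_morphism K H).2.1.
have [lD [D1 _]] := usl2_coproduct_alg q_neq0.
have tens0l (x : H) : tens 0 x = 0 :> tensor H H := bm0l (tens_bilinear _ _) x.
have tens0r (x : H) : tens x 0 = 0 :> tensor H H := bm0r (tens_bilinear _ _) x.
refine (@palg_entries _ _ (usl2_pres q) Hcomatrix _ _ _ Q).
- split; first exact/comatrix1/usl2_coproduct_alg.
  by move=> [] []; rewrite (big_pred1 tt) => [|[]//]; rewrite mul1r.
- move=> I J M N [cM sM] [cN sN].
  split; first exact: (comatrixM (usl2_coproduct_alg q_neq0)).
  move=> [i i'] [j j']; rewrite /kronecker /= -(pair_bigA _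
    (fun k k' => M i k * N i' k' * S (M k j * N k' j'))) /=.
  transitivity (\sum_k M i k * ((i' == j')%:R * S (M k j))).
    apply: eq_bigr => k _; rewrite -sN mulr_suml mulr_sumr.
    apply: eq_bigr => k' _; rewrite -!mulrA; congr (_ * (_ * _)).
    exact: SM.
  rewrite xpair_eqE; case: (i' == j'); rewrite ?andbT ?andbF.
    by under eq_bigr do rewrite mul1r; apply: sM.
  by rewrite big1 // => k _; rewrite mul0r mulr0.
(* Delta E = E (x) K + 1 (x) E and Delta F = F (x) 1 + K^-1 (x) F make E and F
   the off-diagonal entries of triangular comatrices. *)
pose ME := mx2 1 (uE q) 0 (uK q).
pose MF := mx2 (uKinv q) (uF q) 0 1.
have SE : S (uE q) = - (uE q * uKinv q) := usl2_antipode_gen q_neq0 gE.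
have SF : S (uF q) = - (uK q * uF q) := usl2_antipode_gen q_neq0 gF.
have SK : S (uK q) = uKinv q := usl2_antipode_gen q_neq0 gK.
have SK' : S (uKinv q) = uK q := usl2_antipode_gen q_neq0 gKinv.
have S1' : S 1 = 1 := S1.
have D0 := linear_morph0 lD.
have cE : Hcomatrix ME.
  split.
    case=> [] []; rewrite big_bool /= ?usl2_coproduct_gen // ?counit_gen;
      by rewrite ?D0 ?D1 ?tens0l ?tens0r ?addr0 ?add0r ?ctr0 ?ctr1 ?tens1.
  case=> [] []; rewrite big_bool /= ?SE ?SK ?S1' ?S0;
    by rewrite ?mul0r ?mulr0 ?mul1r ?mulr1 ?addr0 ?add0r ?subrr ?uKKinv.
have cF : Hcomatrix MF.
  split.
    case=> [] []; rewrite big_bool /= ?usl2_coproduct_gen // ?counit_gen;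
      by rewrite ?D0 ?D1 ?tens0l ?tens0r ?addr0 ?add0r ?ctr0 ?ctr1 ?tens1.
  case=> [] []; rewrite big_bool /= ?SF ?SK' ?S1' ?S0;
    rewrite ?mul0r ?mulr0 ?mul1r ?mulr1 ?addr0 ?add0r ?uKinvK //.
  by rewrite mulrN mulrA uKinvK mul1r subrr.
case; [exists bool, ME, true, true|exists bool, MF, false, false
  |exists bool, ME, false, true|exists bool, MF, false, true]; by split.
Qed.

End QuantumComatrices.

(** * The product of the double *)

Section Double.
Variables (K : fieldType) (q : K) (phi : Oq q -> Uq q -> K^o).
Hypotheses (q_neq0 : q != 0) (hphi : hopf_pairing phi).
Local Notation C := (Oq q).
Local Notation H := (Uq q).
Local Notation D := (qdouble q).
Local Notation DH := (@usl2_coproduct K q).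
Local Notation DC := (@osl2_coproduct K q).
Local Notation S := (@usl2_antipode K q).
Local Notation mul := (qdouble_mul phi).
Implicit Types I J : finType.
Let bphi := pairing_bilinear hphi.

Fact pairing_bilinear2l h h' :
  bilinear_map (fun c1 c2 => phi c1 h * phi c2 h' : K^o).
Proof.
split=> [c2|c1] k x y /=; rewrite bphi.1; first by rewrite mulrDl scalerAl.
by rewrite mulrDr scalerAr.
Qed.

Fact pairing_bilinear2r c c' :
  bilinear_map (fun h1 h2 => phi c h1 * phi c' h2 : K^o).
Proof.
split=> [h2|h1] k x y /=; rewrite bphi.2; first by rewrite mulrDl scalerAl.
by rewrite mulrDr scalerAr.
Qed.

Lemma pairing_comatrixr I (T : I -> I -> C) i j h h' : comatrix DC T ->
  phi (T i j) (h * h') = \sum_k phi (T i k) h * phi (T k j) h'.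
Proof.
move=> cT; rewrite (pairingMr hphi) sweedler2_comatrix //.
exact: pairing_bilinear2l.
Qed.

Lemma pairing_comatrixl J (M : J -> J -> H) a b c c' : comatrix DH M ->
  phi (c * c') (M a b) = \sum_k phi c (M a k) * phi c' (M k b).
Proof.
move=> cM; rewrite (pairingMl hphi) sweedler2_comatrix //.
exact: pairing_bilinear2r.
Qed.

Lemma pairing_antipoder I (T : I -> I -> C) i j h h' : comatrix DC T ->
  phi (T i j) (S (h * h')) = \sum_k phi (T i k) (S h') * phi (T k j) (S h).
Proof.
move=> cT; rewrite -pairing_comatrixr //; congr phi.
exact: (usl2_antipode_alg q_neq0).2.2.
Qed.

(** The antipode reverses the coproduct; on the side of [H] this is obtained by
moving [S] to [C], where it is an algebra anti-morphism. *)
Lemma pairing_antipodel J (M : J -> J -> H) a b c c' : comatrix DH M ->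
  phi (c * c') (S (M a b)) = \sum_k phi c' (S (M a k)) * phi c (S (M k b)).
Proof.
move=> cM; rewrite -(pairingS hphi).
have -> : osl2_antipode (c * c') = osl2_antipode c' * osl2_antipode c.
  exact: (osl2_antipode_alg q_neq0).2.2.
by rewrite pairing_comatrixl //; apply: eq_bigr => k _;
  rewrite !(pairingS hphi).
Qed.

(** The cross-relation on entries: the comatrix [T] of [C] and the comatrix [M]
of [H] are conjugated by the scalar matrices [phi (T, S M)] and [phi (T, M)],
with rows and columns indexed by pairs [u = (k, c)] and [v = (l, d)]. *)
Lemma qdouble_mul_comatrix I J (T : I -> I -> C) (M : J -> J -> H) c a b i j h :
    comatrix DC T -> comatrix DH M ->
  mul (tens c (M a b)) (tens (T i j) h) =
    \sum_u \sum_v (phi (T i u.1) (S (M a u.2)) * phi (T v.1 j) (M v.2 b)) *: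
      tens (T u.1 v.1 * c) (M u.2 v.2 * h).
Proof.
move=> cT cM; rewrite qdouble_mul_tens // /qdouble_cross.
have b3 := qdouble_mul_bilinear3 c h.
rewrite (sweedler3_comatrix _ _ (osl2_coproduct_alg q_neq0).1 _ _ cT);
  [|move=> c3; exact: qdouble_cross_bilinearC
   |move=> c1 c2; exact: qdouble_cross_linearC].
rewrite -(pair_bigA _ (fun k s => \sum_v (phi (T i k) (S (M a s)) *
  phi (T v.1 j) (M v.2 b)) *: tens (T k v.1 * c) (M s v.2 * h))) /=.
rewrite (linear_morph_sum _ (tensor_lift_linear b3)); apply: eq_bigr => k _.
under [RHS]eq_bigr => s _ do rewrite -(pair_bigA _ (fun l t =>
  (phi (T i k) (S (M a s)) * phi (T l j) (M t b)) *:
    tens (T k l * c) (M s t * h))) /=.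
rewrite (linear_morph_sum _ (tensor_lift_linear b3)) [RHS]exchange_big.
apply: eq_bigr => l _.
rewrite (sweedler3_comatrix _ _ (usl2_coproduct_alg q_neq0).1 _ _ cM);
  [|move=> h3; exact: qdouble_cross_bilinearH
   |move=> h1 h2; exact: qdouble_cross_linearH].
rewrite (linear_morph_sum _ (tensor_lift_linear b3)); apply: eq_bigr => s _.
rewrite (linear_morph_sum _ (tensor_lift_linear b3)); apply: eq_bigr => t _.
by rewrite (linear_morphZ (tensor_lift_linear b3)) tensor_lift_tens.
Qed.

Lemma linear_qdouble_mull y : linear (mul^~ y).
Proof. exact: (qdouble_mul_bilinear q_neq0 hphi).1. Qed.

Lemma linear_qdouble_mulr x : linear (mul x).
Proof. exact: (qdouble_mul_bilinear q_neq0 hphi).2. Qed.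

Lemma qdouble_entries (Q : D -> Prop) :
    (forall k x y, Q x -> Q y -> Q (k *: x + y)) ->
    (forall I J (T : I -> I -> C) (M : J -> J -> H) i j a b,
      comatrix DC T -> Hcomatrix M -> Q (tens (T i j) (M a b))) ->
  forall x, Q x.
Proof.
move=> QP QTM; elim/tensor_ind=> [c h|x y Qx Qy]; last first.
  by rewrite -[x]scale1r; apply: QP.
have [bl br] := tens_bilinear C H.
elim/(Oq_entries q_neq0): c h => [k c c' IHc IHc' h|I T i j cT].
  by rewrite bl; apply: QP.
elim/(Uq_entries q_neq0)=> [k h h' IHh IHh'|J M a b cM]; last exact: QTM.
by rewrite br; apply: QP.
Qed.

(** Nested two-sided conjugations, whose coefficients are themselves matrix
products, flattened into one sum over the indices of the left factors and the
indices of the right factors. *)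
Lemma sum_triples (A B G A' B' G' : finType) (V : lmodType K)
    (a : A -> K) (a1 : A -> B -> G -> K)
    (b : A' -> K) (b1 : A' -> B' -> G' -> K)
    (X : A -> A' -> B -> B' -> V) :
  \sum_u \sum_v (a u * b v) *: \sum_w \sum_z
    ((\sum_g a1 u w g) * (\sum_g b1 v z g)) *: X u v w z =
  \sum_(r : A * B * G) \sum_(s : A' * B' * G')
    ((a r.1.1 * a1 r.1.1 r.1.2 r.2) * (b s.1.1 * b1 s.1.1 s.1.2 s.2)) *:
      X r.1.1 s.1.1 r.1.2 s.1.2.
Proof.
rewrite -(pair_bigA _ (fun p g => \sum_s ((a p.1 * a1 p.1 p.2 g) *
  (b s.1.1 * b1 s.1.1 s.1.2 s.2)) *: X p.1 s.1.1 p.2 s.1.2)) /=.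
rewrite -(pair_bigA _ (fun u w => \sum_g \sum_s ((a u * a1 u w g) *
  (b s.1.1 * b1 s.1.1 s.1.2 s.2)) *: X u s.1.1 w s.1.2)) /=.
apply: eq_bigr => u _; under eq_bigr do rewrite scaler_sumr.
rewrite exchange_big; apply: eq_bigr => w _ /=.
transitivity (\sum_g \sum_v \sum_z \sum_g' ((a u * a1 u w g) *
    (b v * b1 v z g')) *: X u v w z); last first.
  by apply: eq_bigr => g _; rewrite pair_bigA pair_bigA.
rewrite [RHS]exchange_big; apply: eq_bigr => v _.
rewrite scaler_sumr [RHS]exchange_big; apply: eq_bigr => z _.
rewrite scalerA big_distrlr mulr_sumr scaler_suml; apply: eq_bigr => g _ /=.
rewrite mulr_sumr scaler_suml; apply: eq_bigr => g' _.
by rewrite mulrACA.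
Qed.

(** By trilinearity, take [x = c0 M_ab], [y = T_ij N_ef] and [z = T'_mn h0].
The product [x (y z)] uses the comatrix [T' (x) T] of [C], and [(x y) z] the
comatrix [M (x) N] of [H]. Once the pairings with these Kronecker products are
expanded, both sides are the same sum up to renaming of indices. *)
Lemma qdouble_mulA : associative mul.
Proof.
move=> x y z; elim/qdouble_entries: x y z => [k x x' IHx IHx' y z|].
  by rewrite !linear_qdouble_mull IHx IHx'.
move=> I0 J T0 M i0 j0 a b cT0 [cM _] y z.
elim/qdouble_entries: y z => [k y y' IHy IHy' z|].
  by rewrite linear_qdouble_mull !linear_qdouble_mulr linear_qdouble_mull
    IHy IHy'.
move=> I J1 T N i j e f cT [cN _]; elim/qdouble_entries=> [k z z' IHz IHz'|].
  by rewrite !linear_qdouble_mulr IHz IHz'.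
move=> I1 J2 T' M2 m n a2 b2 cT' _; move: (T0 _ _) (M2 _ _) => c0 h0.
have cTT := comatrixM (osl2_coproduct_alg q_neq0) cT' cT.
have cMN := comatrixM (usl2_coproduct_alg q_neq0) cM cN.
have mulTT u v h : mul (tens c0 (M a b)) (tens (T' u v * T i j) h) =
    \sum_w \sum_z
     ((\sum_g phi (T i w.1.2) (S (M a g)) * phi (T' u w.1.1) (S (M g w.2))) *
      (\sum_g phi (T' z.1.1 v) (M z.2 g) * phi (T z.1.2 j) (M g b))) *:
      tens (T' w.1.1 z.1.1 * T w.1.2 z.1.2 * c0) (M w.2 z.2 * h).
  rewrite (qdouble_mul_comatrix c0 a b (u, i) (v, j) h cTT cM).
  apply: eq_bigr => w _; apply: eq_bigr => z _.
  by rewrite pairing_antipodel // pairing_comatrixl.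
have mulMN c u v : mul (tens c (M u v * N e f)) (tens (T' m n) h0) =
    \sum_w \sum_z
     ((\sum_g phi (T' m g) (S (N e w.2.2)) * phi (T' g w.1) (S (M u w.2.1))) *
      (\sum_g phi (T' z.1 g) (M z.2.1 v) * phi (T' g n) (N z.2.2 f))) *:
      tens (T' w.1 z.1 * c) (M w.2.1 z.2.1 * N w.2.2 z.2.2 * h0).
  rewrite (qdouble_mul_comatrix c (u, e) (v, f) m n h0 cT' cMN).
  apply: eq_bigr => w _; apply: eq_bigr => z _.
  by rewrite pairing_antipoder // pairing_comatrixr.
rewrite (qdouble_mul_comatrix _ _ _ _ _ _ cT' cN).
rewrite (qdouble_mul_comatrix _ _ _ _ _ _ cT cM).
rewrite (linear_morph_sum _ (linear_qdouble_mulr _)).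
under eq_bigr => u _.
  rewrite (linear_morph_sum _ (linear_qdouble_mulr _)).
  under eq_bigr => v _ do
    rewrite (linear_morphZ (linear_qdouble_mulr _)) mulTT.
  over.
rewrite (linear_morph_sum _ (linear_qdouble_mull _)).
under [RHS]eq_bigr => u _.
  rewrite (linear_morph_sum _ (linear_qdouble_mull _)).
  under eq_bigr => v _ do
    rewrite (linear_morphZ (linear_qdouble_mull _)) mulMN.
  over.
rewrite !sum_triples.
(* The indices p, e', (k', k, c'), g of x (y z) are k, g, (k', (c', e')), p in
   (x y) z, where g and p come from the expanded pairings. *)
rewrite (reindex (fun r : (I * J) * (I1 * (J * J1)) * I1 =>
  (((r.2, r.1.2.2.2), ((r.1.2.1, r.1.1.1), r.1.2.2.1)), r.1.1.2))) /=; last first.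
  exists (fun r : (I1 * J1) * (I1 * I * J) * J =>
   (((r.1.2.1.2, r.2), (r.1.2.1.1, (r.1.2.2, r.1.1.2))), r.1.1.1));
  by move=> [[[? ?] [[? ?] ?]] ?] _ || move=> [[[? ?] [? [? ?]]] ?] _.
apply: eq_bigr => -[[[k g] [k' [c' e']]] p] _.
(* The same renaming for the right factors. *)
rewrite (reindex (fun r : (I * J) * (I1 * (J * J1)) * I1 =>
  (((r.2, r.1.2.2.2), ((r.1.2.1, r.1.1.1), r.1.2.2.1)), r.1.1.2))) /=; last first.
  exists (fun r : (I1 * J1) * (I1 * I * J) * J =>
   (((r.1.2.1.2, r.2), (r.1.2.1.1, (r.1.2.2, r.1.1.2))), r.1.1.1));
  by move=> [[[? ?] [[? ?] ?]] ?] _ || move=> [[[? ?] [? [? ?]]] ?] _.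
apply: eq_bigr => -[[[l g'] [l' [d' f']]] r] _ /=.
rewrite !mulrA; congr (_ *: tens _ _).
by rewrite [LHS](AC (1*1*1*1*1*1) (2*1*3*6*5*4)).
Qed.

Lemma qdouble_mul1l : left_id (tens 1 1) mul.
Proof.
elim/tensor_ind=> [c h|x y IHx IHy].
  rewrite qdouble_mul_tens // qdouble_cross1l // tensor_lift_tens
    ?mulr1 ?mul1r //.
  exact: qdouble_mul_bilinear3.
by have := linear_morphD (linear_qdouble_mulr (tens 1 1)) x y; rewrite IHx IHy.
Qed.

Lemma qdouble_mul1r : right_id (tens 1 1) mul.
Proof.
elim/tensor_ind=> [c h|x y IHx IHy].
  rewrite qdouble_mul_tens // qdouble_cross1r // tensor_lift_tens
    ?mulr1 ?mul1r //.
  exact: qdouble_mul_bilinear3.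
by have := linear_morphD (linear_qdouble_mull (tens 1 1)) x y; rewrite IHx IHy.
Qed.

(** [phi (T, M)] and [phi (T, S M)] are inverse matrices. *)
Lemma pairing_comatrix_inverse I J (T : I -> I -> C) (M : J -> J -> H) u w :
    comatrix DC T -> Hcomatrix M ->
  \sum_v phi (T u.1 v.1) (M u.2 v.2) * phi (T v.1 w.1) (S (M v.2 w.2)) =
    (u == w)%:R.
Proof.
move=> cT [cM sM]; case: u w => [i a] [k c] /=.
rewrite -(pair_bigA _ (fun l s =>
  phi (T i l) (M a s) * phi (T l k) (S (M s c)))).
rewrite exchange_big /=.
under eq_bigr do rewrite -pairing_comatrixr //.
rewrite -(linear_morph_sum _ (bphi.2 (T i k))) sM xpair_eqE.
case: (a == c); last by rewrite andbF (bm0r bphi).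
by rewrite andbT (pairing1r hphi) (cT i k).2.
Qed.

(** Undoing the conjugation in the cross-relation expresses [c.h] through the
products [h.c]: [c.h = phi(c_1, h_1) phi(c_3, S h_3) h_2 c_2]. *)
Lemma qdouble_reorder I J (T : I -> I -> C) (M : J -> J -> H) i j a b :
    comatrix DC T -> Hcomatrix M ->
  tens (T i j) (M a b) = \sum_(u : I * J) \sum_(v : I * J)
    (phi (T i u.1) (M a u.2) * phi (T v.1 j) (S (M v.2 b))) *:
      mul (tens 1 (M u.2 v.2)) (tens (T u.1 v.1) 1).
Proof.
move=> cT hM; have [cM _] := hM.
under eq_bigr => u _ do under eq_bigr => v _ do
  rewrite (qdouble_mul_comatrix _ _ _ _ _ _ cT cM) scaler_sumr.
under eq_bigr => u _ do rewrite exchange_big /=.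
rewrite exchange_big /=.
transitivity (\sum_w ((i, a) == w)%:R *: \sum_z (z == (j, b))%:R *:
   (tens (T w.1 z.1 * 1) (M w.2 z.2 * 1) : D)).
  rewrite sum_delta; under eq_bigr do rewrite eq_sym.
  by rewrite sum_delta /= !mulr1.
apply: eq_bigr => w _.
under [RHS]eq_bigr => u _ do under eq_bigr => v _ do rewrite scaler_sumr.
under [RHS]eq_bigr => u _ do rewrite exchange_big /=.
rewrite [RHS]exchange_big scaler_sumr; apply: eq_bigr => z _ /=.
rewrite -!(pairing_comatrix_inverse _ _ cT hM) /= scalerA big_distrlr.
rewrite scaler_suml; apply: eq_bigr => u _; rewrite scaler_suml.
apply: eq_bigr => v _; rewrite scalerA; congr (_ *: _).
by rewrite [RHS](AC ((1*1)*(1*1)) ((1*3)*(4*2))).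
Qed.

(** * Actions on the functionals of H (x) C *)

Local Notation dual := (dual_of_tensor phi).

Lemma dual_tens h' c' c h : dual (tens h' c') (tens c h) = phi c h' * phi c' h.
Proof.
have bb (y : D) : bilinear_map (fun h' c' =>
    tensor_lift (fun c h => phi c h' * phi c' h : K^o) y).
  split=> [c1|h1]; apply: tensor_lift_param => c2 h2 k x x' /=.
    by rewrite bphi.2 mulrDl scalerAl.
  by rewrite bphi.1 mulrDr scalerAr.
rewrite /dual_of_tensor (tensor_lift_tens (bb _)) tensor_lift_tens //.
split=> [c1|h1] k x y /=; rewrite ?bphi.1 ?bphi.2.
  by rewrite mulrDl scalerAl.
by rewrite mulrDr scalerAr.
Qed.

Lemma dual_linear : linear (dual : tensor (Uq q) (Oq q) -> (D -> K^o)).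
Proof.
move=> k x x'; apply/funext => y; apply: tensor_lift_linear.
split=> [c1|h1]; apply: tensor_lift_param => c2 h2 l z z' /=.
  by rewrite bphi.2 mulrDl scalerAl.
by rewrite bphi.1 mulrDr scalerAr.
Qed.

(** [h' (x) c'] is sent by [c] to [h'_1 phi(c, h'_2) (x) c']. If [h' = M_ab],
this is a combination of the [M_ak (x) c']. *)
Lemma ract_O_spanned x : exists s : seq (D -> K^o),
  forall c, spanned s (qdouble_ract phi (tens c 1) (dual x)).
Proof.
(* Only linearity of f matters: f is the identity, or tens with one fixed
   argument. *)
have PP (V : lmodType K) (f : V -> tensor H C) k u v : linear f ->
    (exists s : seq (D -> K^o), forall c,
      spanned s (qdouble_ract phi (tens c 1) (dual (f u)))) ->
    (exists s : seq (D -> K^o), forall c,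
      spanned s (qdouble_ract phi (tens c 1) (dual (f v)))) ->
    (exists s : seq (D -> K^o), forall c,
      spanned s (qdouble_ract phi (tens c 1) (dual (f (k *: u + v))))).
  move=> lf [s sP] [t tP]; exists (s ++ t) => c.
  rewrite lf dual_linear.
  by apply: (spannedP k (spanned_catl t (sP c)) (spanned_catr s (tP c))).
elim/tensor_ind: x => [h c'|x y IHx IHy]; last first.
  by rewrite -[x]scale1r; apply: (PP _ id).
elim/(Uq_entries q_neq0): h => [k u v IHu IHv|J M a b [cM _]].
  exact: (PP _ (fun h => tens h c') k u v ((tens_bilinear H C).1 c')).
exists [seq dual (tens (M a k) c') | k <- enum J] => c.
suff -> : qdouble_ract phi (tens c 1) (dual (tens (M a b) c')) =
    \sum_k (phi c (M k b) : K) *: (dual (tens (M a k) c') : D -> K^o).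
  exact: spanned_family.
have lR := qdouble_ract_dual q_neq0 hphi (tens c 1)
  (dual_of_tensor_dual hphi (tens (M a b) c')).
apply/funext; elim/tensor_ind=> [c1 h1|y y' IHy IHy']; last first.
  rewrite (linear_morphD lR) IHy IHy' !lincomb_fctE -big_split.
  apply: eq_bigr => k _; rewrite (linear_morphD (dual_of_tensor_dual hphi _)).
  exact/esym/scalerDr.
rewrite /qdouble_ract qdouble_mul_tens // qdouble_cross1l //.
rewrite tensor_lift_tens ?mul1r; last exact: qdouble_mul_bilinear3.
rewrite dual_tens pairing_comatrixl // mulr_suml lincomb_fctE.
apply: eq_bigr => k _; rewrite dual_tens.
change (phi c1 (M a k) * phi c (M k b) * phi c' h1 =
  phi c (M k b) * (phi c1 (M a k) * phi c' h1)).
by rewrite mulrCA mulrA.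
Qed.

(** [h' (x) c'] is sent by [h] to [S(h_1) h' h_3 (x) phi(c'_1, h_2) c'_2]. *)
Lemma ract_U_dual x h : exists x',
  qdouble_ract phi (tens 1 h) (dual x) = dual x'.
Proof.
have bDH := qdouble_mul_bilinear q_neq0 hphi.
have bt := tens_bilinear C H.
have bt' := tens_bilinear H C.
elim/(Uq_entries q_neq0): h x => [k h1 h2 IH1 IH2 x|J M a b [cM _]].
  have [[x1 e1] [x2 e2]] := (IH1 x, IH2 x); exists (k *: x1 + x2).
  rewrite dual_linear -e1 -e2; apply/funext => y.
  by rewrite /qdouble_ract bt.2 bDH.1 (dual_of_tensor_dual hphi).
elim/tensor_ind=> [h c|x y [x' ex] [y' ey]]; last first.
  by exists (x' + y'); rewrite !(linear_morphD dual_linear) -ex -ey.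
elim/(Oq_entries q_neq0): c => [k c1 c2 [x1 e1] [x2 e2]|I T i j cT].
  by exists (k *: x1 + x2); rewrite bt'.2 !dual_linear -e1 -e2.
exists (\sum_c \sum_d \sum_p (phi (T i p) (M c d) : K) *:
  tens (S (M a c) * h * M d b) (T p j)).
have lR := qdouble_ract_dual q_neq0 hphi (tens 1 (M a b))
  (dual_of_tensor_dual hphi (tens h (T i j))).
apply/funext; elim/qdouble_entries=> [k y y' IHy IHy'|I1 J1 U N m n e f cU _].
  by rewrite lR IHy IHy' (dual_of_tensor_dual hphi).
have lf := dual_of_tensor_dual hphi (tens h (T i j)).
rewrite /qdouble_ract (qdouble_mul_comatrix _ _ _ _ _ _ cU cM).
rewrite (linear_morph_sum _ lf).
transitivity (\sum_u \sum_v
   (phi (U m u.1) (S (M a u.2)) * phi (U v.1 n) (M v.2 b)) *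
   (phi (U u.1 v.1) h * \sum_p phi (T i p) (M u.2 v.2) * phi (T p j) (N e f))).
  apply: eq_bigr => u _; rewrite (linear_morph_sum _ lf); apply: eq_bigr => v _.
  by rewrite (linear_morphZ lf) mulr1 dual_tens pairing_comatrixr.
have le : linear (fun z => dual z (tens (U m n) (N e f)) : K^o).
  by move=> k z z'; rewrite dual_linear.
rewrite (linear_morph_sum _ le).
under [RHS]eq_bigr => c _.
  rewrite (linear_morph_sum _ le).
  under eq_bigr => d _.
    rewrite (linear_morph_sum _ le).
    under eq_bigr => p _ do
      rewrite (linear_morphZ le) dual_tens pairing_comatrixr //.
    over.
  over.
pose P c d := \sum_p phi (T i p) (M c d) * phi (T p j) (N e f).
transitivity (\sum_c \sum_d \sum_k \sum_l
    (phi (U m k) (S (M a c)) * phi (U l n) (M d b)) * (phi (U k l) h * P c d)).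
  rewrite -(pair_bigA _ (fun k c => \sum_v (phi (U m k) (S (M a c)) *
    phi (U v.1 n) (M v.2 b)) * (phi (U k v.1) h * P c v.2))) exchange_big /=.
  apply: eq_bigr => c _; rewrite [RHS]exchange_big; apply: eq_bigr => k _ /=.
  rewrite [RHS]exchange_big /= pair_bigA; apply: eq_bigr => -[l d] _ //.
apply: eq_bigr => c _ /=; apply: eq_bigr => d _ /=.
transitivity ((\sum_l phi (U m l) (S (M a c) * h) *
  phi (U l n) (M d b)) * P c d).
  rewrite exchange_big mulr_suml; apply: eq_bigr => l _ /=.
  rewrite pairing_comatrixr // !mulr_suml; apply: eq_bigr => k _.
  by rewrite mulrA; congr (_ * _); rewrite -!mulrA; congr (_ * _);
    rewrite mulrC.
rewrite mulr_sumr; apply: eq_bigr => p _.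
exact: mulrCA.
Qed.

(** * Local finiteness *)

Lemma qdouble_ract_linear f : qdouble_dual f ->
  linear (fun x => qdouble_ract phi x f).
Proof.
move=> lf k x x'; apply/funext => y.
by rewrite /qdouble_ract linear_qdouble_mull lf.
Qed.

Lemma qdouble_ract_mul x y f :
  qdouble_ract phi y (qdouble_ract phi x f) = qdouble_ract phi (mul x y) f.
Proof. by apply/funext => z; rewrite /qdouble_ract qdouble_mulA. Qed.

Lemma qdouble_lact_mul x y f :
  qdouble_lact phi x (qdouble_lact phi y f) = qdouble_lact phi (mul x y) f.
Proof. by apply/funext => z; rewrite /qdouble_lact qdouble_mulA. Qed.

Lemma qdouble_lact_ract x y f :
  qdouble_lact phi x (qdouble_ract phi y f) =
  qdouble_ract phi y (qdouble_lact phi x f).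
Proof.
by apply/funext => z; rewrite /qdouble_lact /qdouble_ract qdouble_mulA.
Qed.

Lemma ract_orbit_spanned x (s : seq (D -> K^o)) :
    (forall h, spanned s (qdouble_ract phi (tens 1 h) (dual x))) ->
  exists t : seq (D -> K^o), forall y, spanned t (qdouble_ract phi y (dual x)).
Proof.
move=> sP; have ldx := dual_of_tensor_dual hphi x.
have lR := qdouble_ract_linear ldx.
have lH : linear (fun h => qdouble_ract phi (tens 1 h) (dual x)).
  by move=> k h h'; rewrite (tens_bilinear C H).2 lR.
pose V : set (D -> K^o) :=
  [set g | exists h, g = qdouble_ract phi (tens 1 h) (dual x)]%classic.
have [||g [h ->] //|t [tV tP]] := finite_dim_sub (N := V) (s := s).
- by exists 0; rewrite (linear_morph0 lH).
- by move=> k _ _ [h ->] [h' ->]; exists (k *: h + h'); rewrite lH.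
have [||t' t'P] := spanned_uniform (s := t)
  (F := fun c => qdouble_ract phi (tens c 1)).
- by [].
- move=> i; have [h ->] := tV i; have [x' ->] := ract_U_dual x h.
  exact: ract_O_spanned.
(* R_{hc} = R_c R_h, and the products h.c span the double. *)
exists t'; elim/qdouble_entries=> [k y y' IHy IHy'|I J T M i j a b cT cM].
  by rewrite lR; apply: spannedP.
rewrite (qdouble_reorder _ _ _ _ cT cM).
rewrite (linear_morph_sum _ lR); apply: spanned_sum => u.
rewrite (linear_morph_sum _ lR); apply: spanned_sum => v.
rewrite (linear_morphZ lR); apply: spannedZ; rewrite -qdouble_ract_mul.
have [|a' ->] := tP (qdouble_ract phi (tens 1 (M u.2 v.2)) (dual x)).
  by exists (M u.2 v.2).
exact/t'P/spanned_lincomb.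
Qed.

(** The span of the right orbit of [f] is generated by finitely many [f_j] in
that orbit. The right orbit of [f_j] lies in the span of [s] too, so, by
transposition, the left orbit of [f_j] has finite-dimensional span. *)
Lemma bimodule_orbit_spanned f (s : seq (D -> K^o)) : qdouble_dual f ->
    (forall y, spanned s (qdouble_ract phi y f)) ->
  exists t : seq (D -> K^o), forall x y,
    spanned t (qdouble_lact phi x (qdouble_ract phi y f)).
Proof.
move=> lf sP; have lR := qdouble_ract_linear lf.
pose V : set (D -> K^o) := [set g | exists y, g = qdouble_ract phi y f]%classic.
have [||g [h ->] //|t [tV tP]] := finite_dim_sub (N := V) (s := s).
- by exists 0; rewrite (linear_morph0 lR).
- by move=> k _ _ [h ->] [h' ->]; exists (k *: h + h'); rewrite lR.
have [||t' t'P] := spanned_uniform (F := qdouble_lact phi) (s := t).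
- by [].
- move=> i; have [y ->] := tV i.
  have [|t' t'P] := @spanned_transpose K D D s
    (fun z => qdouble_ract phi z (qdouble_ract phi y f)).
    by move=> z; rewrite qdouble_ract_mul.
  by exists t' => x; apply: t'P.
exists t' => x y; have [|a ->] := tP (qdouble_ract phi y f); first by exists y.
exact/t'P/spanned_lincomb.
Qed.

Lemma locally_finite_of_bimodule f (s : seq (D -> K^o)) : qdouble_dual f ->
    (forall x y, spanned s (qdouble_lact phi x (qdouble_ract phi y f))) ->
  qdouble_locally_finite phi f.
Proof.
move=> lf sP; have [sD D0 DP Dl Dr] := qdouble_dual_sub_bimodule q_neq0 hphi.
(* N is stable under both actions because they are actions, and it lies in the
   span of s because the unit acts trivially. *)
pose N : set (D -> K^o) := [set g | qdouble_dual g /\ forall x y,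
  spanned s (qdouble_lact phi x (qdouble_ract phi y g))]%classic.
have bN : sub_bimodule (@qdouble_dual K q) (qdouble_lact phi)
    (qdouble_ract phi) N.
  split.
  - by move=> g [].
  - by split=> // x y; apply: spanned0.
  - move=> c g g' [lg sg] [lg' sg']; split; first exact: DP.
    by move=> x y; apply: (spannedP c (sg x y) (sg' x y)).
  - move=> z g [lg sg]; split; first exact: Dl.
    by move=> x y; rewrite -qdouble_lact_ract qdouble_lact_mul.
  - move=> z g [lg sg]; split; first exact: Dr.
    by move=> x y; rewrite qdouble_ract_mul.
apply: (locally_finite_spanned (N := N) (s := s)) => // g gS.
have [_ /(_ (tens 1 1) (tens 1 1))] : N g by apply: gS; split=> // _ ->.
suff -> : qdouble_lact phi (tens 1 1) (qdouble_ract phi (tens 1 1) g) = g by [].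
apply/funext => z.
by rewrite /qdouble_lact /qdouble_ract qdouble_mul1r qdouble_mul1l.
Qed.

Local Notation Hlact := (fun h => qdouble_lact phi (qdouble_of_U h)).
Local Notation Hract := (fun h => qdouble_ract phi (qdouble_of_U h)).

Lemma sub_bimodule_of_U (N : set (D -> K^o)) :
  sub_bimodule (@qdouble_dual K q) (qdouble_lact phi) (qdouble_ract phi) N ->
  sub_bimodule (@qdouble_dual K q) Hlact Hract N.
Proof. by case=> ND N0 NP Nl Nr; split=> // x; [apply: Nl | apply: Nr]. Qed.

Lemma locally_finite_double_U f : qdouble_dual f ->
  qdouble_locally_finite phi f -> usl2_locally_finite phi f.
Proof.
move=> lf /finite_dim_spanned[s sP].
have bD := qdouble_dual_sub_bimodule q_neq0 hphi.
apply: (locally_finite_spanned (sub_bimodule_of_U bD) lf (s := s)) => g gS.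
by apply: sP => N [/sub_bimodule_of_U bN fN]; apply: gS.
Qed.

Lemma locally_finite_U_double x :
  usl2_locally_finite phi (dual x) -> qdouble_locally_finite phi (dual x).
Proof.
move=> /finite_dim_spanned[s sP]; have lx := dual_of_tensor_dual hphi x.
have [h|t tP] := @ract_orbit_spanned x s.
  apply: sP => N [bN fN]; apply: (sub_bimodule_ract bN h); exact: fN.
have [t' t'P] := bimodule_orbit_spanned lx tP.
exact: locally_finite_of_bimodule lx t'P.
Qed.

End Double.

Theorem proposition1p8 (R : realType)
    (phi : Oq (qvar R) -> Uq (qvar R) -> ((Cq R)^o)%R)
    (hphi : hopf_pairing phi) (x : tensor (Uq (qvar R)) (Oq (qvar R))) :
  qdouble_locally_finite phi (dual_of_tensor phi x) <->
  usl2_locally_finite phi (dual_of_tensor phi x).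
Proof.
split; first exact: (locally_finite_double_U (qvar_neq0 R) hphi
  (dual_of_tensor_dual hphi x)).
exact: (locally_finite_U_double (qvar_neq0 R) hphi).
Qed.
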